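(* Let $k$ be a field, $n\ge2$, and let $p\in k[x]$ be a reducible monic polynomial of degree two. Any twisted tensor product $k^n\otimes_\tau k[x]/(p(x))$ is isomorphic, as a $k$-algebra, to an algebra of the form $$\mathcal{M}_2(k)^t\times kQ_{<2},$$ where $t\ge 0$ is an integer and $Q$ is some (finite, possibly empty) quiver.
   Context: Algebras are unital associative $k$-algebras, maps are $k$-linear, $\otimes=\otimes_k$. For algebras $A,B$ a twisting map is a linear map $\tau:B\otimes A\to A\otimes B$ with $\tau\circ(B\otimes\mu_A)=(\mu_A\otimes B)\circ(A\otimes\tau)\circ(\tau\otimes A)$, $\tau\circ(\mu_B\otimes A)=(A\otimes\mu_B)\circ(\tau\otimes B)\circ(B\otimes\tau)$, $\tau(1\otimes a)=a\otimes1$, $\tau(b\otimes1)=1\otimes b$; the twisted tensor product $A\otimes_\tau B$ is $A\otimes B$ with product $(\mu_A\otimes\mu_B)\circ(A\otimes\tau\otimes B)$. For a quiver $Q$, $kQ_{<2}:=kQ/(Q_{\ge2})$ is the quotient of the path algebra $kQ$ by the ideal generated by all paths of length greater than one (the zero algebra if $Q$ is empty). *)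

(* Defs.v *)
From HB Require Import structures.
From mathcomp Require Import all_boot all_algebra.
From mathcomp Require Import boolp finmap monalg.

Set Implicit Arguments.
Unset Strict Implicit.
Unset Printing Implicit Defensive.

Import GRing.Theory.
Local Open Scope ring_scope.
Local Open Scope quotient_scope.

(* Unital associative k-algebras, the zero algebra included: it occurs here   *)
(* as M_2(k)^0 and as the algebra of the empty quiver, and [algType] excludes *)
(* it. Since Hierarchy-Builder accepts no second join of modules and rings,   *)
(* the product is a new operation; on library rings it is instantiated by *%R.*)
HB.mixin Record isKAlgebra (k : fieldType) A of GRing.Lmodule k A := {
  aone : A;
  amul : A -> A -> A;
  amulA : associative amul;
  amul1 : left_id aone amul;
  amula1 : right_id aone amul;
  amul_linearl : forall y, linear (amul^~ y);
  amul_linearr : forall x, linear (amul x) }.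

#[short(type="kalgType")]
HB.structure Definition KAlgebra (k : fieldType) :=
  {A of isKAlgebra k A & GRing.Lmodule k A}.

#[short(type="fdkalgType")]
HB.structure Definition FDKAlgebra (k : fieldType) :=
  {A of KAlgebra k A & Vector k A}.

Arguments aone {k s}.
Arguments amul {k s} : simpl never.
Notation "x ** y" := (amul x y) (at level 40, left associativity) : ring_scope.

Definition kalg_morphism (k : fieldType) (A B : kalgType k) (f : A -> B) : Prop :=
  [/\ linear f, f aone = aone & {morph f : x y / x ** y}].

Definition kalg_isog (k : fieldType) (A B : kalgType k) : Prop :=
  exists2 f : A -> B, kalg_morphism f & bijective f.

Section Instances.
Variable k : fieldType.

Section Alg.
Variable A : algType k.
Fact alg_linearl (y : A) : linear (fun x => x * y).
Proof. by move=> c u v; rewrite mulrDl scalerAl. Qed.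
Fact alg_linearr (x : A) : linear (fun y => x * y).
Proof. by move=> c u v; rewrite mulrDr scalerAr. Qed.
End Alg.

HB.instance Definition _ := isKAlgebra.Build k k^o
  (@mulrA k) (@mul1r k) (@mulr1 k) (@alg_linearl k^o) (@alg_linearr k^o).
HB.instance Definition _ := Vector.on k^o.

(* {poly %/ p} is k[x]/(p) for p monic and nonconstant; for other p the       *)
(* library replaces the modulus p by 'X.                                      *)
HB.instance Definition _ (p : {poly k}) := isKAlgebra.Build k {poly %/ p}
  (@mulrA _) (@mul1r _) (@mulr1 _)
  (@alg_linearl {poly %/ p}) (@alg_linearr {poly %/ p}).
HB.instance Definition _ (p : {poly k}) := Vector.on {poly %/ p}.

Section Matrix.
Variable n : nat.
Fact mx_linearl (B : 'M[k]_n) : linear (mulmx^~ B : 'M[k]_n -> 'M[k]_n).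
Proof. by move=> c u v; rewrite mulmxDl scalemxAl. Qed.
Fact mx_linearr (B : 'M[k]_n) : linear (mulmx B : 'M[k]_n -> 'M[k]_n).
Proof. by move=> c u v; rewrite mulmxDr scalemxAr. Qed.
HB.instance Definition _ := isKAlgebra.Build k 'M[k]_n
  (@mulmxA k n n n n) (@mul1mx k n n) (@mulmx1 k n n) mx_linearl mx_linearr.
End Matrix.

Section FFun.
Variables (I : finType) (A : kalgType k).
Definition ffun_amul (x y : {ffun I -> A}) := [ffun i => x i ** y i].
Definition ffun_aone : {ffun I -> A} := [ffun=> aone].
Fact ffun_amulA : associative ffun_amul.
Proof. by move=> x y z; apply/ffunP=> i; rewrite !ffunE amulA. Qed.
Fact ffun_amul1 : left_id ffun_aone ffun_amul.
Proof. by move=> x; apply/ffunP=> i; rewrite !ffunE amul1. Qed.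
Fact ffun_amula1 : right_id ffun_aone ffun_amul.
Proof. by move=> x; apply/ffunP=> i; rewrite !ffunE amula1. Qed.
Fact ffun_linearl y : linear (ffun_amul^~ y).
Proof. by move=> c u v; apply/ffunP=> i; rewrite !ffunE amul_linearl. Qed.
Fact ffun_linearr x : linear (ffun_amul x).
Proof. by move=> c u v; apply/ffunP=> i; rewrite !ffunE amul_linearr. Qed.
HB.instance Definition _ := isKAlgebra.Build k {ffun I -> A}
  ffun_amulA ffun_amul1 ffun_amula1 ffun_linearl ffun_linearr.
End FFun.
HB.instance Definition _ (I : finType) (A : fdkalgType k) :=
  Vector.on {ffun I -> A}.

Section Prod.
Variables A B : kalgType k.
Definition prod_amul (x y : A * B) : A * B := (x.1 ** y.1, x.2 ** y.2).
Definition prod_aone : A * B := (aone, aone).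
Fact prod_amulA : associative prod_amul.
Proof. by move=> x y z; rewrite /prod_amul /= !amulA. Qed.
Fact prod_amul1 : left_id prod_aone prod_amul.
Proof. by case=> x y; rewrite /prod_amul /= !amul1. Qed.
Fact prod_amula1 : right_id prod_aone prod_amul.
Proof. by case=> x y; rewrite /prod_amul /= !amula1. Qed.
Fact prod_linearl y : linear (prod_amul^~ y).
Proof. by move=> c u v; rewrite /prod_amul /= !amul_linearl. Qed.
Fact prod_linearr x : linear (prod_amul x).
Proof. by move=> c u v; rewrite /prod_amul /= !amul_linearr. Qed.
HB.instance Definition _ := isKAlgebra.Build k (A * B)%type
  prod_amulA prod_amul1 prod_amula1 prod_linearl prod_linearr.
End Prod.

End Instances.

(* Tensor products of finite-dimensional spaces: coordinates of an element of *)
(* U (x) V in the products of the basis vectors carried by U and V.           *)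
Section Tensor.
Import VectorInternalTheory.
Variable k : fieldType.

Definition tensor (U V : vectType k) := 'M[k]_(dim U, dim V).
HB.instance Definition _ U V := Vector.on (tensor U V).

(* [pure] and [tlift] are locked to keep unification from unfolding them. *)
Fact tensor_key : unit. Proof. by []. Qed.

Definition pure (U V : vectType k) : U -> V -> tensor U V :=
  locked_with tensor_key (fun u v => (v2r u)^T *m v2r v).

Lemma pureE (U V : vectType k) (u : U) (v : V) :
  pure u v = (v2r u)^T *m v2r v.
Proof. by rewrite /pure unlock. Qed.

Definition bilin (U V W : lmodType k) (f : U -> V -> W) : Prop :=
  (forall u, linear (f u)) /\ (forall v, linear (f^~ v)).

(* The linear map U (x) V -> W induced by a bilinear map f. *)
Definition tlift (U V : vectType k) (W : lmodType k) :
    (U -> V -> W) -> tensor U V -> W :=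
  locked_with tensor_key (fun f x =>
    \sum_i \sum_j x i j *: f (r2v (delta_mx 0 i)) (r2v (delta_mx 0 j))).

Lemma tliftE (U V : vectType k) (W : lmodType k) (f : U -> V -> W) x :
  tlift f x =
  \sum_i \sum_j x i j *: f (r2v (delta_mx 0 i)) (r2v (delta_mx 0 j)).
Proof. by rewrite /tlift unlock. Qed.

Section Theory.
Variables U V : vectType k.

Lemma pure_bilin : bilin (@pure U V).
Proof.
split=> [u c v1 v2|v c u1 u2]; rewrite !pureE.
  by rewrite linearP mulmxDr -scalemxAr.
by rewrite !linearP mulmxDl -scalemxAl.
Qed.

Lemma tlift_linear (W : lmodType k) (f : U -> V -> W) : linear (tlift f).
Proof.
move=> c x y; rewrite !tliftE scaler_sumr -big_split /=; apply: eq_bigr => i _.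
rewrite scaler_sumr -big_split /=; apply: eq_bigr => j _.
by rewrite !mxE scalerDl scalerA.
Qed.
HB.instance Definition _ (W : lmodType k) (f : U -> V -> W) :=
  GRing.isLinear.Build k (tensor U V) W _ (tlift f) (@tlift_linear W f).

Lemma tlift_pure (W : lmodType k) (f : U -> V -> W) u v :
  bilin f -> tlift f (pure u v) = f u v.
Proof.
case=> fr fl.
pose fl' w := GRing.isLinear.Build k U W _ (f^~ w) (fl w).
pose fL w : {linear U -> W} := HB.pack (f^~ w) (fl' w).
pose fr' w := GRing.isLinear.Build k V W _ (f w) (fr w).
pose fR w : {linear V -> W} := HB.pack (f w) (fr' w).
have eu : u = \sum_i v2r u 0 i *: r2v (delta_mx 0 i).
  rewrite -[LHS]v2rK [in LHS](row_sum_delta (v2r u)) linear_sum /=.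
  by apply: eq_bigr => i _; rewrite linearZ.
have ev : v = \sum_i v2r v 0 i *: r2v (delta_mx 0 i).
  rewrite -[LHS]v2rK [in LHS](row_sum_delta (v2r v)) linear_sum /=.
  by apply: eq_bigr => i _; rewrite linearZ.
rewrite tliftE.
transitivity (fL v (\sum_i v2r u 0 i *: r2v (delta_mx 0 i))); last first.
  by rewrite -eu.
rewrite linear_sum; apply: eq_bigr => i _; rewrite linearZ /=.
transitivity (v2r u 0 i *: fR (r2v (delta_mx 0 i))
    (\sum_j v2r v 0 j *: r2v (delta_mx 0 j))); last by rewrite -ev.
rewrite linear_sum scaler_sumr; apply: eq_bigr => j _.
rewrite linearZ /= scalerA; congr (_ *: _).
by rewrite pureE mxE big_ord1 !mxE.
Qed.

(* Two linear maps that agree on pure tensors are equal; with [tlift_pure]    *)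
(* this is the universal property of (tensor U V, pure).                      *)
Lemma tensor_ext (W : lmodType k) (f g : {linear tensor U V -> W}) :
  (forall u v, f (pure u v) = g (pure u v)) -> f =1 g.
Proof.
move=> fg x; rewrite (matrix_sum_delta x) !linear_sum /=; apply: eq_bigr => i _.
rewrite !linear_sum; apply: eq_bigr => j _; rewrite !linearZ /=; congr (_ *: _).
have -> : delta_mx i j = pure (r2v (delta_mx 0 i) : U) (r2v (delta_mx 0 j) : V).
  by rewrite pureE !r2vK trmx_delta mul_delta_mx.
exact: fg.
Qed.

End Theory.

Definition tmap (U V U' V' : vectType k) (f : U -> U') (g : V -> V') :
    tensor U V -> tensor U' V' :=
  tlift (fun u v => pure (f u) (g v)).

Definition tassoc (U V W : vectType k) :
    tensor (tensor U V) W -> tensor U (tensor V W) :=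
  tlift (fun x w => tlift (fun u v => pure u (pure v w)) x).

Definition tunassoc (U V W : vectType k) :
    tensor U (tensor V W) -> tensor (tensor U V) W :=
  tlift (fun u x => tlift (fun v w => pure (pure u v) w) x).

Definition tmul (A : fdkalgType k) : tensor A A -> A := tlift (@amul k A).

End Tensor.
Arguments tassoc {k U V W} x.
Arguments tunassoc {k U V W} x.
Arguments tmul {k A} x.

Section Linearity.
Variable k : fieldType.
HB.instance Definition _ (U V U' V' : vectType k) (f : U -> U') (g : V -> V') :=
  GRing.Linear.copy (tmap f g) (tlift (fun u v => pure (f u) (g v))).
HB.instance Definition _ (U V W : vectType k) :=
  GRing.Linear.copy (@tassoc k U V W)
    (tlift (fun x w => tlift (fun u v => pure u (pure v w)) x)).
HB.instance Definition _ (U V W : vectType k) :=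
  GRing.Linear.copy (@tunassoc k U V W)
    (tlift (fun u x => tlift (fun v w => pure (pure u v) w) x)).
HB.instance Definition _ (A : fdkalgType k) :=
  GRing.Linear.copy (@tmul k A) (tlift (@amul k A)).
End Linearity.

Section TensorTheory.
Variable k : fieldType.
Implicit Types U V W : vectType k.

Lemma purePl U V c (u1 u2 : U) (v : V) :
  pure (c *: u1 + u2) v = c *: pure u1 v + pure u2 v.
Proof. exact: (pure_bilin U V).2. Qed.

Lemma purePr U V c (u : U) (v1 v2 : V) :
  pure u (c *: v1 + v2) = c *: pure u v1 + pure u v2.
Proof. exact: (pure_bilin U V).1. Qed.

Lemma tensor_ext_lin U V (W : lmodType k) (f g : tensor U V -> W) :
  linear f -> linear g -> (forall u v, f (pure u v) = g (pure u v)) -> f =1 g.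
Proof.
move=> lf lg.
pose f' := GRing.isLinear.Build k (tensor U V) W _ f lf.
pose g' := GRing.isLinear.Build k (tensor U V) W _ g lg.
pose F : {linear _ -> _} := HB.pack f f'.
pose G : {linear _ -> _} := HB.pack g g'.
exact: (@tensor_ext k U V W F G).
Qed.

Lemma tmap_pure U V U' V' (f : U -> U') (g : V -> V') u v :
  linear f -> linear g -> tmap f g (pure u v) = pure (f u) (g v).
Proof.
move=> lf lg; rewrite /tmap tlift_pure //.
by split=> [x|y] c a b /=; rewrite (lf, lg) (purePl, purePr).
Qed.

Lemma tlift_linear_param (U V : vectType k) (W P : lmodType k)
    (f : P -> U -> V -> W) x :
  (forall u v, linear (fun p => f p u v)) -> linear (fun p => tlift (f p) x).
Proof.
move=> lf c p q; rewrite !tliftE scaler_sumr -big_split /=; apply: eq_bigr => i _.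
rewrite scaler_sumr -big_split /=; apply: eq_bigr => j _.
by rewrite lf scalerDr !scalerA mulrC.
Qed.

Lemma tassoc_pure U V W (u : U) (v : V) (w : W) :
  tassoc (pure (pure u v) w) = pure u (pure v w).
Proof.
rewrite /tassoc tlift_pure; first last.
  split=> [x|w']; last exact: tlift_linear.
  by apply: tlift_linear_param => u' v' c a b; rewrite !purePr.
by rewrite tlift_pure //; split=> [x|y] c a b; rewrite ?purePl ?purePr ?purePl.
Qed.

Lemma tunassoc_pure U V W (u : U) (v : V) (w : W) :
  tunassoc (pure u (pure v w)) = pure (pure u v) w.
Proof.
rewrite /tunassoc tlift_pure; first last.
  split=> [x|w']; first exact: tlift_linear.
  by apply: tlift_linear_param => u' v' c a b; rewrite !purePl.
by rewrite tlift_pure //; split=> [x|y] c a b; rewrite ?purePr ?purePl.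
Qed.

Lemma tmul_pure (A : fdkalgType k) (x y : A) : tmul (pure x y) = x ** y.
Proof.
rewrite /tmul tlift_pure //.
by split=> z; [apply: amul_linearr | apply: amul_linearl].
Qed.

Lemma tmapl_pure U V U' (f : {linear U -> U'}) (u : U) (v : V) :
  tmap f idfun (pure u v) = pure (f u) v.
Proof. by rewrite tmap_pure //; apply: linearP. Qed.

Lemma tmapr_pure U V V' (g : {linear V -> V'}) (u : U) (v : V) :
  tmap idfun g (pure u v) = pure u (g v).
Proof. by rewrite tmap_pure //; apply: linearP. Qed.

Lemma tmap_tmul_pure (A B : fdkalgType k) (x : tensor A A) (y : tensor B B) :
  tmap tmul tmul (pure x y) = pure (tmul x) (tmul y).
Proof. by rewrite tmap_pure //; apply: linearP. Qed.

Lemma tmap_amull_pure (A B : fdkalgType k) (a x : A) (y : B) :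
  tmap (amul a) idfun (pure x y) = pure (a ** x) y.
Proof. by rewrite tmap_pure //; apply: amul_linearr. Qed.

Lemma tmap_amulr_pure (A B : fdkalgType k) (x : A) (b y : B) :
  tmap idfun (amul^~ b) (pure x y) = pure x (y ** b).
Proof. by rewrite tmap_pure //; apply: amul_linearl. Qed.

Lemma tmap_amul_pure (A B : fdkalgType k) (a x : A) (b y : B) :
  tmap (amul a) (amul^~ b) (pure x y) = pure (a ** x) (y ** b).
Proof.
by rewrite tmap_pure //; [apply: amul_linearr | apply: amul_linearl].
Qed.

End TensorTheory.

Record twisting (k : fieldType) (A B : fdkalgType k) := Twisting {
  twist :> {linear tensor B A -> tensor A B};
  twist_mulA : forall x : tensor B (tensor A A),
    twist (tmap idfun tmul x) =
    tmap tmul idfun (tunassoc (tmap idfun twist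
      (tassoc (tmap twist idfun (tunassoc x)))));
  twist_mulB : forall x : tensor (tensor B B) A,
    twist (tmap tmul idfun x) =
    tmap idfun tmul (tassoc (tmap twist idfun
      (tunassoc (tmap idfun twist (tassoc x)))));
  twist_1A : forall a : A, twist (pure aone a) = pure a aone;
  twist_1B : forall b : B, twist (pure b aone) = pure aone b }.

Definition twisted (k : fieldType) (A B : fdkalgType k) (tau : twisting A B) :=
  tensor A B.

Section Twisted.
Variables (k : fieldType) (A B : fdkalgType k) (tau : twisting A B).

HB.instance Definition _ := Vector.on (twisted tau).

Definition twisted_one : twisted tau := pure aone aone.

Definition twisted_mul (x y : twisted tau) : twisted tau :=
  tmap tmul tmul (tunassoc (tmap idfun tassoc (tmap idfun (tmap tau idfun)
    (tmap idfun tunassoc (tassoc (pure (x : tensor A B) (y : tensor A B))))))).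

Local Notation "x *t y" := (twisted_mul x y)
  (at level 40, left associativity).
Local Notation T := (tensor A B).

Fact twisted_linearl y : linear (twisted_mul^~ y).
Proof. by move=> c u v; rewrite /twisted_mul purePl !linearP. Qed.

Fact twisted_linearr x : linear (twisted_mul x).
Proof. by move=> c u v; rewrite /twisted_mul purePr !linearP. Qed.

Lemma twisted_mul_pure a b a' b' :
  (pure a b : T) *t (pure a' b' : T) =
  tmap (amul a) (amul^~ b') (tau (pure b a')).
Proof.
rewrite /twisted_mul tassoc_pure tmapr_pure /= tunassoc_pure.
rewrite tmapr_pure /= tmapl_pure /= tmapr_pure /=.
move: (tau _) => X.
apply: (@tensor_ext_lin k A B _
  (fun X => tmap tmul tmul (tunassoc (pure a (tassoc (pure X b')))))) X.
- by move=> c x y; rewrite purePl linearP purePr !linearP.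
- exact: linearP.
move=> a1 b1; rewrite tassoc_pure tunassoc_pure tmap_tmul_pure.
by rewrite !tmul_pure tmap_amul_pure.
Qed.

(* (1 (x) b) (a Y) = tau (b (x) a) Y *)
Let mulAr b a (Y : T) :
  (pure aone b : T) *t (tmap (amul a) idfun Y) = (tau (pure b a) : T) *t Y.
Proof.
apply: (@tensor_ext_lin k A B _
   (fun Y => (pure aone b : T) *t (tmap (amul a) idfun Y))) Y.
- by move=> c x y; rewrite linearP twisted_linearr.
- exact: twisted_linearr.
move=> a2 b2; rewrite tmap_amull_pure twisted_mul_pure.
have -> : tau (pure b (a ** a2)) = tau (tmap idfun tmul (pure b (pure a a2))).
  by rewrite tmapr_pure /= tmul_pure.
rewrite twist_mulA tunassoc_pure tmapl_pure /=.
move: (tau (pure b a)) => X.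
apply: (@tensor_ext_lin k A B _ (fun X => tmap (amul aone) (amul^~ b2)
  (tmap tmul idfun (tunassoc (tmap idfun tau (tassoc (pure X (idfun a2)))))))
  (fun X => (X : T) *t (pure a2 b2 : T))) X.
- by move=> c x y; rewrite purePl !linearP.
- exact: twisted_linearl.
move=> a1 b1; rewrite tassoc_pure tmapr_pure /=.
rewrite twisted_mul_pure; move: (tau _) => X.
apply: (@tensor_ext_lin k A B _ (fun X => tmap (amul aone) (amul^~ b2)
  (tmap tmul idfun (tunassoc (pure (idfun a1) X))))) X.
- by move=> c x y; rewrite purePr !linearP.
- exact: linearP.
move=> a3 b3; rewrite tunassoc_pure tmapl_pure /= !tmap_amul_pure.
by rewrite tmul_pure amul1.
Qed.

(* (X b) (a (x) 1) = X tau (b (x) a) *)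
Let mulBl b a (X : T) :
  (tmap idfun (amul^~ b) X) *t (pure a aone : T) = X *t (tau (pure b a) : T).
Proof.
apply: (@tensor_ext_lin k A B _
   (fun X => (tmap idfun (amul^~ b) X) *t (pure a aone : T))
   (fun X => (X : T) *t (tau (pure b a) : T))) X.
- by move=> c x y; rewrite linearP twisted_linearl.
- exact: twisted_linearl.
move=> a1 b1; rewrite tmap_amulr_pure twisted_mul_pure.
have -> : tau (pure (b1 ** b) a) = tau (tmap tmul idfun (pure (pure b1 b) a)).
  by rewrite tmapl_pure /= tmul_pure.
rewrite twist_mulB tassoc_pure tmapr_pure /=.
move: (tau (pure b a)) => Y.
apply: (@tensor_ext_lin k A B _ (fun Y => tmap (amul (idfun a1)) (amul^~ aone)
  (tmap idfun tmul (tassoc (tmap tau idfun (tunassoc (pure (idfun b1) Y))))))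
  (fun Y => (pure a1 b1 : T) *t (Y : T))) Y.
- by move=> c x y; rewrite purePr !linearP.
- exact: twisted_linearr.
move=> a2 b2; rewrite tunassoc_pure tmapl_pure /=.
rewrite twisted_mul_pure; move: (tau _) => Y.
apply: (@tensor_ext_lin k A B _ (fun Y => tmap (amul (idfun a1)) (amul^~ aone)
  (tmap idfun tmul (tassoc (pure Y (idfun b2)))))) Y.
- by move=> c x y; rewrite purePl !linearP.
- exact: linearP.
move=> a3 b3; rewrite tassoc_pure tmapr_pure /= !tmap_amul_pure.
by rewrite tmul_pure amula1.
Qed.

Let mulAl a (X Y : T) :
  (tmap (amul a) idfun X) *t Y = tmap (amul a) idfun (X *t Y).
Proof.
apply: (@tensor_ext_lin k A B _ (fun X => (tmap (amul a) idfun X) *t Y)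
   (fun X => tmap (amul a) idfun ((X : T) *t Y))) X.
- by move=> c x y; rewrite linearP twisted_linearl.
- by move=> c x y; rewrite twisted_linearl linearP.
move=> a1 b1.
apply: (@tensor_ext_lin k A B _
   (fun Y => (tmap (amul a) idfun (pure a1 b1)) *t (Y : T))
   (fun Y => tmap (amul a) idfun ((pure a1 b1 : T) *t (Y : T)))) Y.
- exact: twisted_linearr.
- by move=> c x y; rewrite twisted_linearr linearP.
move=> a2 b2; rewrite tmap_amull_pure !twisted_mul_pure; move: (tau _) => Z.
apply: (@tensor_ext_lin k A B _ _ (fun Z => tmap (amul a) idfun
   (tmap (amul a1) (amul^~ b2) Z))) Z.
- exact: linearP.
- by move=> c x y; rewrite !linearP.
by move=> a3 b3; rewrite !tmap_amul_pure tmap_amull_pure amulA.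
Qed.

Let mulBr b (X Y : T) :
  X *t (tmap idfun (amul^~ b) Y) = tmap idfun (amul^~ b) (X *t Y).
Proof.
apply: (@tensor_ext_lin k A B _ (fun X => (X : T) *t (tmap idfun (amul^~ b) Y))
   (fun X => tmap idfun (amul^~ b) ((X : T) *t Y))) X.
- exact: twisted_linearl.
- by move=> c x y; rewrite twisted_linearl linearP.
move=> a1 b1.
apply: (@tensor_ext_lin k A B _
   (fun Y => (pure a1 b1 : T) *t (tmap idfun (amul^~ b) Y))
   (fun Y => tmap idfun (amul^~ b) ((pure a1 b1 : T) *t (Y : T)))) Y.
- by move=> c x y; rewrite linearP twisted_linearr.
- by move=> c x y; rewrite twisted_linearr linearP.
move=> a2 b2; rewrite tmap_amulr_pure !twisted_mul_pure; move: (tau _) => Z.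
apply: (@tensor_ext_lin k A B _ _ (fun Z => tmap idfun (amul^~ b)
   (tmap (amul a1) (amul^~ b2) Z))) Z.
- exact: linearP.
- by move=> c x y; rewrite !linearP.
by move=> a3 b3; rewrite !tmap_amul_pure tmap_amulr_pure amulA.
Qed.

Fact twisted_mulA : associative twisted_mul.
Proof.
move=> X Y Z.
apply: (@tensor_ext_lin k A B _ (fun X => (X : T) *t (Y *t Z))
  (fun X => (X : T) *t Y *t Z)) X.
- exact: twisted_linearl.
- by move=> c x y; rewrite !twisted_linearl.
move=> a b.
apply: (@tensor_ext_lin k A B _ (fun Y => (pure a b : T) *t ((Y : T) *t Z))
  (fun Y => (pure a b : T) *t (Y : T) *t Z)) Y.
- by move=> c x y; rewrite twisted_linearl twisted_linearr.
- by move=> c x y; rewrite twisted_linearr twisted_linearl.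
move=> a' b'.
apply: (@tensor_ext_lin k A B _
  (fun Z => (pure a b : T) *t ((pure a' b' : T) *t (Z : T)))
  (fun Z => (pure a b : T) *t (pure a' b' : T) *t (Z : T))) Z.
- by move=> c x y; rewrite !twisted_linearr.
- exact: twisted_linearr.
move=> a2 b2.
have eX : pure a b = tmap (amul a) idfun (pure aone b).
  by rewrite tmap_amull_pure amula1.
have eZ : pure a2 b2 = tmap idfun (amul^~ b2) (pure a2 aone).
  by rewrite tmap_amulr_pure amul1.
rewrite eX eZ !mulAl !mulBr; congr (tmap _ _ (tmap _ _ _)).
have -> : (pure aone b : T) *t (pure a' b' : T) =
          tmap idfun (amul^~ b') (tau (pure b a')).
  rewrite twisted_mul_pure; move: (tau _) => W.
  apply: tensor_ext_lin W; try exact: linearP.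
  by move=> a3 b3; rewrite tmap_amul_pure tmap_amulr_pure amul1.
have -> : (pure a' b' : T) *t (pure a2 aone : T) =
          tmap (amul a') idfun (tau (pure b' a2)).
  rewrite twisted_mul_pure; move: (tau _) => W.
  apply: tensor_ext_lin W; try exact: linearP.
  by move=> a3 b3; rewrite tmap_amul_pure tmap_amull_pure amula1.
by rewrite mulAr mulBl.
Qed.

Fact twisted_mul1 : left_id twisted_one twisted_mul.
Proof.
apply: tensor_ext_lin; [exact: twisted_linearr | by [] | move=> a b].
by rewrite twisted_mul_pure twist_1A tmap_amul_pure !amul1.
Qed.

Fact twisted_mulone : right_id twisted_one twisted_mul.
Proof.
apply: tensor_ext_lin; [exact: twisted_linearl | by [] | move=> a b].
by rewrite twisted_mul_pure twist_1B tmap_amul_pure !amula1.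
Qed.

HB.instance Definition _ := isKAlgebra.Build k (twisted tau)
  twisted_mulA twisted_mul1 twisted_mulone twisted_linearl twisted_linearr.

End Twisted.

Section QuotientAlgebra.
Variables (k : fieldType) (A : kalgType k).

Definition two_sided_ideal (J : A -> Prop) : Prop :=
  [/\ J 0, forall x y, J x -> J y -> J (x + y)
    & forall a x b, J x -> J (a ** x ** b)].

Definition ideal_gen (S : A -> Prop) : {pred A} := fun x =>
  `[< forall J, two_sided_ideal J -> (forall y, S y -> J y) -> J x >].

Variable S : A -> Prop.

Lemma ideal_genP x : reflect
  (forall J, two_sided_ideal J -> (forall y, S y -> J y) -> J x)
  (x \in ideal_gen S).
Proof. exact: asboolP. Qed.

Lemma ideal_genM a x b : x \in ideal_gen S -> a ** x ** b \in ideal_gen S.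
Proof.
move/ideal_genP=> Sx; apply/ideal_genP=> J Jid SJ.
by have [_ _] := Jid; apply; apply: Sx.
Qed.

Lemma ideal_genMl a x : x \in ideal_gen S -> a ** x \in ideal_gen S.
Proof. by move/(ideal_genM a aone); rewrite amula1. Qed.

Lemma ideal_genMr b x : x \in ideal_gen S -> x ** b \in ideal_gen S.
Proof. by move/(ideal_genM aone b); rewrite amul1. Qed.

Lemma ideal_genZ c x : x \in ideal_gen S -> c *: x \in ideal_gen S.
Proof.
move/(ideal_genMl (c *: aone)).
have := amul_linearl x c aone 0; rewrite addr0 => ->.
have := amul_linearl x (-1) 0 0; rewrite !(addr0, scaler0) => e.
suff -> : (0 : A) ** x = 0 by rewrite addr0 amul1.
by move: e; rewrite scaleN1r addNr.
Qed.

Fact ideal_gen_zmod : zmod_closed (ideal_gen S).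
Proof.
have D x y : x \in ideal_gen S -> y \in ideal_gen S -> x + y \in ideal_gen S.
  move=> /ideal_genP Sx /ideal_genP Sy; apply/ideal_genP=> J Jid SJ.
  by have [_ JD _] := Jid; apply: JD; [apply: Sx | apply: Sy].
split=> [|x y Sx Sy]; first by apply/ideal_genP=> J [].
by apply: D => //; rewrite -scaleN1r ideal_genZ.
Qed.
HB.instance Definition _ := GRing.isZmodClosed.Build A (ideal_gen S)
  ideal_gen_zmod.

Definition quotient_algebra := Quotient.quot (ideal_gen S).
Local Notation Q := quotient_algebra.

HB.instance Definition _ := GRing.Zmodule.on Q.
HB.instance Definition _ : EqQuotient A (Quotient.equiv (ideal_gen S)) Q :=
  EqQuotient.on Q.

Definition quot_scale (c : k) : Q -> Q := lift_op1 Q ( *:%R c).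
Definition quot_mul : Q -> Q -> Q := lift_op2 Q amul.
Definition quot_one : Q := \pi_Q aone.

Lemma amulBl (x y z : A) : (x - y) ** z = x ** z - y ** z.
Proof.
by rewrite -[in LHS]scaleN1r addrC amul_linearl scaleN1r addrC.
Qed.

Lemma amulBr (x y z : A) : z ** (x - y) = z ** x - z ** y.
Proof.
by rewrite -[in LHS]scaleN1r addrC amul_linearr scaleN1r addrC.
Qed.

Lemma pi_eq (x y : A) : (\pi_Q x == \pi_Q y) = (x - y \in ideal_gen S).
Proof. by rewrite -Quotient.idealrBE. Qed.

Lemma pi_quot_scale c x : quot_scale c (\pi_Q x) = \pi_Q (c *: x).
Proof.
rewrite /quot_scale; unlock; apply/eqP; rewrite pi_eq -scalerBr ideal_genZ //.
by rewrite -pi_eq reprK.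
Qed.

Lemma pi_quot_mul x y : quot_mul (\pi_Q x) (\pi_Q y) = \pi_Q (x ** y).
Proof.
rewrite /quot_mul; unlock; apply/eqP; rewrite pi_eq.
rewrite -(subrKA (repr (\pi_Q x) ** y)) rpredD //.
  by rewrite -amulBr ideal_genMl // -pi_eq reprK.
by rewrite -amulBl ideal_genMr // -pi_eq reprK.
Qed.

Lemma pi_quot_add x y : \pi_Q x + \pi_Q y = \pi_Q (x + y) :> Q.
Proof. by rewrite !piE. Qed.

Lemma quotP (P : Q -> Prop) : (forall x, P (\pi_Q x)) -> forall q, P q.
Proof. by move=> Ppi q; rewrite -[q]reprK. Qed.

Fact quot_scaleA a b v : quot_scale a (quot_scale b v) = quot_scale (a * b) v.
Proof. by elim/quotP: v => v; rewrite !pi_quot_scale scalerA. Qed.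
Fact quot_scale1 : left_id 1 quot_scale.
Proof. by elim/quotP=> v; rewrite pi_quot_scale scale1r. Qed.
Fact quot_scaleDr : right_distributive quot_scale +%R.
Proof.
move=> c; elim/quotP=> u; elim/quotP=> v.
by rewrite pi_quot_add !pi_quot_scale pi_quot_add scalerDr.
Qed.
Fact quot_scaleDl v : {morph quot_scale^~ v : a b / a + b}.
Proof.
move=> a b; elim/quotP: v => v.
by rewrite !pi_quot_scale pi_quot_add scalerDl.
Qed.
HB.instance Definition _ := GRing.Zmodule_isLmodule.Build k Q
  quot_scaleA quot_scale1 quot_scaleDr quot_scaleDl.

Fact quot_mulA : associative quot_mul.
Proof.
elim/quotP=> x; elim/quotP=> y; elim/quotP=> z.
by rewrite !pi_quot_mul amulA.
Qed.
Fact quot_mul1 : left_id quot_one quot_mul.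
Proof. by elim/quotP=> x; rewrite pi_quot_mul amul1. Qed.
Fact quot_mulone : right_id quot_one quot_mul.
Proof. by elim/quotP=> x; rewrite pi_quot_mul amula1. Qed.
Fact quot_linearl y : linear (quot_mul^~ y).
Proof.
move=> c; elim/quotP=> u; elim/quotP=> v; elim/quotP: y => y.
by rewrite -[c *: _]/(quot_scale _ _) -[X in _ = X + _]/(quot_scale _ _)
  !(pi_quot_add, pi_quot_scale, pi_quot_mul) amul_linearl.
Qed.
Fact quot_linearr x : linear (quot_mul x).
Proof.
move=> c; elim/quotP=> u; elim/quotP=> v; elim/quotP: x => x.
by rewrite -[c *: _]/(quot_scale _ _) -[X in _ = X + _]/(quot_scale _ _)
  !(pi_quot_add, pi_quot_scale, pi_quot_mul) amul_linearr.
Qed.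
HB.instance Definition _ := isKAlgebra.Build k Q
  quot_mulA quot_mul1 quot_mulone quot_linearl quot_linearr.

End QuotientAlgebra.

Section FreeModule.
Variables (k : fieldType) (K : choiceType) (W : lmodType k).

(* The linear extension of F to the free module on K. *)
Definition mlift (F : K -> W) (x : {malg k[K]}) : W :=
  \sum_(i <- msupp x) x@_i *: F i.

Lemma mliftEw (F : K -> W) x (d : {fset K}) : (msupp x `<=` d)%fset ->
  mlift F x = \sum_(i <- d) x@_i *: F i.
Proof.
move=> sxd; rewrite /mlift (big_fset_incl _ sxd) // => i _ /mcoeff_outdom ->.
by rewrite scale0r.
Qed.

Lemma mlift_linear (F : K -> W) : linear (mlift F).
Proof.
move=> c x y; pose d := (msupp (c *: x + y) `|` msupp x `|` msupp y)%fset.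
have sd z : z \in [:: c *: x + y; x; y] -> (msupp z `<=` d)%fset.
  by rewrite !inE => /or3P[] /eqP->; apply/fsubsetP=> i; rewrite !inE => ->;
    rewrite ?orbT.
rewrite !(@mliftEw F _ d) ?sd ?inE ?eqxx ?orbT //.
rewrite scaler_sumr -big_split /=; apply: eq_bigr => i _.
by rewrite mcoeffD mcoeffZ scalerDl scalerA.
Qed.

Lemma mliftU (F : K -> W) i : mlift F << i >> = F i.
Proof. by rewrite (mliftEw _ msuppU_le) big_seq_fset1 mcoeffUU scale1r. Qed.

Lemma malgUE (c : k) (i : K) : << c *g i >> = c *: << i >>.
Proof.
by apply/malgP=> j; rewrite mcoeffZ !mcoeffU mulr_natr.
Qed.

Lemma malg_ext (f g : {malg k[K]} -> W) :
  linear f -> linear g -> (forall i, f << i >> = g << i >>) -> f =1 g.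
Proof.
move=> lf lg fg.
pose f' := GRing.isLinear.Build k {malg k[K]} W _ f lf.
pose g' := GRing.isLinear.Build k {malg k[K]} W _ g lg.
pose F : {linear _ -> _} := HB.pack f f'.
pose G : {linear _ -> _} := HB.pack g g'.
move=> x; have E (h : {linear {malg k[K]} -> W}) :
    h x = \sum_(i <- msupp x) x@_i *: h << i >>.
  rewrite [in LHS](monalgE x) linear_sum; apply: eq_bigr => i _.
  by rewrite malgUE linearZ.
rewrite [LHS](E F) [RHS](E G); apply: eq_bigr => i _.
by congr (_ *: _); apply: fg.
Qed.

Lemma mlift_param (P : lmodType k) (F : P -> K -> W) x :
  (forall i, linear (F^~ i)) -> linear (fun p => mlift (F p) x).
Proof.
move=> lF c p q; rewrite /mlift scaler_sumr -big_split /=; apply: eq_bigr=> i _.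
by rewrite lF scalerDr !scalerA mulrC.
Qed.

End FreeModule.

Record quiver := Quiver {
  vertex : finType;
  arrow : finType;
  source : arrow -> vertex;
  target : arrow -> vertex }.

Section Paths.
Variable Q : quiver.

Fixpoint is_walk (v : vertex Q) (s : seq (arrow Q)) : bool :=
  if s is e :: s' then (source e == v) && is_walk (target e) s' else true.

Definition walk_end (v : vertex Q) (s : seq (arrow Q)) : vertex Q :=
  last v (map (@target Q) s).

(* A path is its starting vertex and its arrows in order of traversal; at     *)
(* every vertex v there is the trivial path (v, [::]).                        *)
Definition qpath := {x : vertex Q * seq (arrow Q) | is_walk x.1 x.2}.

Definition psource (p : qpath) : vertex Q := (val p).1.
Definition parrows (p : qpath) : seq (arrow Q) := (val p).2.
Definition ptarget (p : qpath) : vertex Q := walk_end (psource p) (parrows p).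
Definition plength (p : qpath) : nat := size (parrows p).

Definition ptriv (v : vertex Q) : qpath :=
  exist (fun x => is_walk x.1 x.2) (v, [::]) isT.

(* First p, then q. *)
Definition pcomp (p q : qpath) : option qpath :=
  if ptarget p == psource q
  then insub (psource p, parrows p ++ parrows q) : option qpath else None.

Lemma is_walk_cat v s t :
  is_walk v (s ++ t) = is_walk v s && is_walk (walk_end v s) t.
Proof. by elim: s v => //= e s IHs v; rewrite IHs andbA. Qed.

Variant pcomp_spec (p q : qpath) : option qpath -> Prop :=
| PcompSome r of ptarget p = psource q & psource r = psource p
    & ptarget r = ptarget q & parrows r = parrows p ++ parrows q :
    pcomp_spec p q (Some r)
| PcompNone of ptarget p <> psource q : pcomp_spec p q None.

Lemma pcompP p q : pcomp_spec p q (pcomp p q).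
Proof.
rewrite /pcomp; case: eqP => [pq|]; last by constructor.
have w : is_walk (psource p) (parrows p ++ parrows q).
  by rewrite is_walk_cat (valP p) -/(ptarget p) pq (valP q).
rewrite (@insubT _ (fun x => is_walk x.1 x.2) _ (_, _) w); constructor=> //.
rewrite /ptarget /walk_end /psource /parrows /= map_cat last_cat.
by move: pq; rewrite /ptarget /walk_end => ->.
Qed.

Lemma qpath_eq (p q : qpath) :
  psource p = psource q -> parrows p = parrows q -> p = q.
Proof.
case: p q => -[v s] ws [[w t] wt] evw est; apply: val_inj => /=.
by congr pair; [apply: evw | apply: est].
Qed.

Lemma pcompA p q r :
  obind (pcomp p) (pcomp q r) = obind (pcomp^~ r) (pcomp p q).
Proof.
case: (pcompP q r) => [qr e1 s1 t1 a1|ne1];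
  case: (pcompP p q) => [pq e2 s2 t2 a2|ne2] //=.
- case: (pcompP p qr) => [x _ s3 _ a3|]; last by rewrite s1 e2.
  case: (pcompP pq r) => [y _ s4 _ a4|]; last by rewrite t2 e1.
  by congr Some; apply: qpath_eq; rewrite ?s3 ?s4 ?a3 ?a4 ?a1 ?a2 ?catA.
- by case: (pcompP p qr) => // x e; case: ne2; rewrite e s1.
- by case: (pcompP pq r) => // x e; case: ne1; rewrite -e t2.
Qed.

Lemma pcomp1p p : pcomp (ptriv (psource p)) p = Some p.
Proof.
case: pcompP => [r _ s _ a|]; last by case.
by congr Some; apply: qpath_eq.
Qed.

Lemma pcompp1 p : pcomp p (ptriv (ptarget p)) = Some p.
Proof.
case: pcompP => [r _ s _ a|]; last by case.
by congr Some; apply: qpath_eq; rewrite // a cats0.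
Qed.

End Paths.

Section PathAlgebra.
Variables (k : fieldType) (Q : quiver).

Definition path_algebra := {malg k[qpath Q]}.
HB.instance Definition _ := GRing.Lmodule.on path_algebra.

(* Locked to keep unification from computing with finite maps. *)
Fact path_elt_key : unit. Proof. by []. Qed.
Definition path_elt : qpath Q -> path_algebra :=
  locked_with path_elt_key (fun p => << p >>).

Lemma path_eltE p : path_elt p = << p >>.
Proof. by rewrite /path_elt unlock. Qed.

Lemma path_ext (W : lmodType k) (f g : path_algebra -> W) :
  linear f -> linear g -> (forall p, f (path_elt p) = g (path_elt p)) -> f =1 g.
Proof. by move=> lf lg fg; apply: malg_ext => // p; rewrite -path_eltE. Qed.

Definition pathU_mul (p q : qpath Q) : path_algebra :=
  oapp path_elt 0 (pcomp p q).

Definition path_mul (x y : path_algebra) : path_algebra :=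
  mlift (fun p => mlift (pathU_mul p) y) x.

Definition path_one : path_algebra := \sum_(v : vertex Q) path_elt (ptriv v).

Fact path_linearl y : linear (path_mul^~ y).
Proof. exact: mlift_linear. Qed.

Fact path_linearr x : linear (path_mul x).
Proof. by apply: mlift_param => p; apply: mlift_linear. Qed.

Lemma path_mulUU p q : path_mul (path_elt p) (path_elt q) = pathU_mul p q.
Proof. by rewrite /path_mul !path_eltE !mliftU. Qed.

Fact path_mul0l y : path_mul 0 y = 0.
Proof. by have := path_linearl y (-1) 0 0; rewrite !scaleN1r !addNr. Qed.

Fact path_mul0r x : path_mul x 0 = 0.
Proof. by have := path_linearr x (-1) 0 0; rewrite !scaleN1r !addNr. Qed.

Fact path_mul_suml y (I : finType) (F : I -> path_algebra) :
  path_mul (\sum_i F i) y = \sum_i path_mul (F i) y.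
Proof.
apply: (big_morph (path_mul^~ y) _ (path_mul0l y)) => u v.
by rewrite -[u]scale1r path_linearl !scale1r.
Qed.

Fact path_mul_sumr x (I : finType) (F : I -> path_algebra) :
  path_mul x (\sum_i F i) = \sum_i path_mul x (F i).
Proof.
apply: (big_morph (path_mul x) _ (path_mul0r x)) => u v.
by rewrite -[u]scale1r path_linearr !scale1r.
Qed.

Fact path_mulA : associative path_mul.
Proof.
have comp (f g : path_algebra -> path_algebra) :
  linear f -> linear g -> linear (fun x => f (g x)).
  by move=> lf lg c u v; rewrite lg lf.
move=> x y z; move: x; apply: path_ext.
- exact: path_linearl.
- by apply: (comp (path_mul^~ z) (path_mul^~ y)); apply: path_linearl.
move=> p; move: y; apply: path_ext.
- apply: (comp (path_mul (path_elt p)) (path_mul^~ z)).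
    exact: path_linearr.
  exact: path_linearl.
- apply: (comp (path_mul^~ z) (path_mul (path_elt p))).
    exact: path_linearl.
  exact: path_linearr.
move=> q; move: z; apply: path_ext.
- by apply: (comp (path_mul (path_elt p)) (path_mul (path_elt q))); apply: path_linearr.
- exact: path_linearr.
move=> r; rewrite !path_mulUU.
transitivity (oapp path_elt 0 (obind (pcomp p) (pcomp q r))).
  rewrite /pathU_mul; case: (pcomp q r) => [qr|] /=; last exact: path_mul0r.
  by rewrite path_mulUU.
rewrite pcompA /pathU_mul; case: (pcomp p q) => [pq|] /=.
  by rewrite path_mulUU.
by rewrite path_mul0l.
Qed.

Fact path_mul1 : left_id path_one path_mul.
Proof.
apply: path_ext => [||p]; first exact: path_linearr.
  by [].
rewrite path_mul_suml (bigD1 (psource p)) //=.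
rewrite path_mulUU /pathU_mul pcomp1p /= big1 ?addr0 // => v /eqP nv.
by rewrite path_mulUU /pathU_mul; case: pcompP.
Qed.

Fact path_mulone : right_id path_one path_mul.
Proof.
apply: path_ext => [||p]; first exact: path_linearl.
  by [].
rewrite path_mul_sumr (bigD1 (ptarget p)) //=.
rewrite path_mulUU /pathU_mul pcompp1 /= big1 ?addr0 // => v /eqP nv.
by rewrite path_mulUU /pathU_mul; case: pcompP => // r e; case: nv.
Qed.

HB.instance Definition _ := isKAlgebra.Build k path_algebra
  path_mulA path_mul1 path_mulone path_linearl path_linearr.

Definition long_path (x : path_algebra) : Prop :=
  exists2 p : qpath Q, (2 <= plength p)%N & x = path_elt p.

Definition path_algebra_lt2 : kalgType k := quotient_algebra long_path.

End PathAlgebra.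

(* Main.v *)
Require Import Defs.
From mathcomp Require Import all_boot all_algebra.
From mathcomp Require Import boolp finmap monalg ring.

(** Write p = (X - a)(X - b) and g = b - a, and let y be the class of X - a, so
that y^2 = g y in k[x]/(p). With e_i the standard idempotents of k^n, the
twisted product T has the basis e_i, e_i y, and all that follows is drawn from
associativity of T on this basis.

Expand e_i y e_j = d_ij e_i + a_ij e_i y. For fixed i the a_ij are orthogonal
idempotents of the field k with sum 1, so a_ij = 1 for exactly one index
j = s(i) and a_ij = 0 for the others. The d_ij are then determined by
c_i = d_(i, s(i)), and w_i = e_i y + c_i e_i satisfies
w_i = e_i w_i e_(s(i)) ([shift_exists]). So T resembles the path algebra of a
quiver with one arrow w_i : i -> s(i) for each i, except that
  w_i w_(s(i)) = u_i w_i - v_i e_i,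
  u_i = g + c_i + c_(s(i)),  v_i = c_i (g + c_i).
Associativity of w_i w_(s(i)) e_l gives s(s(i)) = s(i) when u_i is nonzero and
s(s(i)) = i when v_i is nonzero. This leaves three situations.
 - v_i is nonzero. Then i and s(i) form a 2-cycle of s, the arrows w_i and
   w_(s(i)) are inverse to each other up to a scalar, and associativity forbids
   any other arrow to enter the cycle: it spans a factor M_2(k).
 - s(i) = i and g is nonzero. Then w_i / g is an idempotent, so that the vertex
   i splits into two vertices; an arrow w_j into i has w_j w_i = u_j w_j with
   u_j = g or u_j = 0, which tells at which of the two vertices it ends.
 - Otherwise w_i is an arrow whose products with all such arrows vanish.

After rescaling the w_i, the product of any two basis vectors is zero or again
a basis vector. An algebra is determined up to isomorphism by such a
multiplication table ([has_table_isog]). The table of T is computed in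
[has_table_twisted], that of kQ_{<2} in [has_table_path_algebra_lt2], and
[table_index_bij] with [table_indexM] match the table of T to that of
M_2(k)^t x kQ_{<2}. *)

Set Implicit Arguments.
Unset Strict Implicit.
Unset Printing Implicit Defensive.

Import GRing.Theory.
Local Open Scope ring_scope.
Local Open Scope quotient_scope.

(** * Multiplication tables *)

Section AlgebraSums.
Variables (k : fieldType) (A : kalgType k).
Implicit Types (x y : A) (c : k).

Lemma amul0l y : 0 ** y = 0 :> A.
Proof. by rewrite -[X in X ** _](subrr (0 : A)) amulBl subrr. Qed.

Lemma amul0r x : x ** 0 = 0 :> A.
Proof. by rewrite -[X in _ ** X](subrr (0 : A)) amulBr subrr. Qed.

Lemma amulZl c x y : (c *: x) ** y = c *: (x ** y).
Proof. by rewrite -[c *: x]addr0 amul_linearl amul0l addr0. Qed.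

Lemma amulZr c x y : x ** (c *: y) = c *: (x ** y).
Proof. by rewrite -[c *: y]addr0 amul_linearr amul0r addr0. Qed.

Lemma amulDl x1 x2 y : (x1 + x2) ** y = x1 ** y + x2 ** y.
Proof. by rewrite -[x1]scale1r amul_linearl !scale1r. Qed.

Lemma amulDr x y1 y2 : x ** (y1 + y2) = x ** y1 + x ** y2.
Proof. by rewrite -[y1]scale1r amul_linearr !scale1r. Qed.

Lemma amul_suml (I : finType) (F : I -> A) y :
  (\sum_i F i) ** y = \sum_i F i ** y.
Proof. exact: (big_morph (amul^~ y) (fun u v => amulDl u v y) (amul0l y)). Qed.

Lemma amul_sumr (I : finType) (F : I -> A) x :
  x ** (\sum_i F i) = \sum_i x ** F i.
Proof. exact: (big_morph (amul x) (amulDr x) (amul0r x)). Qed.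

End AlgebraSums.

Section Tables.
Variable k : fieldType.

(** The coordinate functions are part of the notion of basis: an isomorphism is
then given by a formula, and dimensions need not be counted. *)
Definition coordinates (V : lmodType k) (I : finType) (b : I -> V)
    (f : V -> I -> k) : Prop :=
  [/\ forall i, scalar (f^~ i), forall i j, f (b i) j = (i == j)%:R
    & forall x, x = \sum_i f x i *: b i].

(** A basis that together with 0 is closed under multiplication: [m i j] is the
index of the product of the basis vectors i and j, or [None] if it vanishes. *)
Definition has_table (A : kalgType k) (I : finType) (m : I -> I -> option I) :
    Prop :=
  exists b : I -> A, (exists f, coordinates b f) /\
    forall i j, b i ** b j = oapp b 0 (m i j).

Lemma scalar0 (V : lmodType k) (f : V -> k) : scalar f -> f 0 = 0.
Proof. by move=> lf; have := lf (-1) 0 0; rewrite scaler0 addr0 mulN1r addNr. Qed.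

Lemma scalar_sum (V : lmodType k) (f : V -> k) (J : finType) (c : J -> k)
    (x : J -> V) :
  scalar f -> f (\sum_j c j *: x j) = \sum_j c j * f (x j).
Proof.
move=> lf; have f0 := scalar0 lf.
have fD u v : f (u + v) = f u + f v.
  by have := lf 1 u v; rewrite scale1r mul1r.
rewrite (big_morph f fD f0).
by apply: eq_bigr => j _; rewrite -[c j *: _]addr0 lf f0 addr0.
Qed.

Lemma sum_delta (I : finType) (c : I -> k) j : \sum_i c i * (i == j)%:R = c j.
Proof.
rewrite (bigD1 j) //= eqxx mulr1 big1 ?addr0 // => i /negPf->.
by rewrite mulr0.
Qed.

Lemma coord_sum (V : lmodType k) (I : finType) (b : I -> V) f (c : I -> k) :
  coordinates b f -> f (\sum_i c i *: b i) =1 c.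
Proof.
move=> [lf fb _] j; rewrite (scalar_sum _ _ (lf j)) -[RHS]sum_delta.
by apply: eq_bigr => i _; rewrite fb.
Qed.

(** The linear map between the bases is bijective and multiplicative. It
preserves the unit because the image of the unit is neutral for the products
of elements of the image, which is everything. *)
Lemma has_table_isog (A B : kalgType k) (I : finType) (m : I -> I -> option I) :
  has_table A m -> has_table B m -> kalg_isog A B.
Proof.
move=> [a [[f cf] am]] [b [[g cg] bm]].
have [lf fa fK] := cf; have [lg gb gK] := cg.
pose F (x : A) : B := \sum_i f x i *: b i.
pose G (y : B) : A := \sum_i g y i *: a i.
have FK : cancel F G.
  by move=> x; rewrite [RHS]fK; apply: eq_bigr => i _; rewrite (coord_sum _ cg).
have GK : cancel G F.
  by move=> y; rewrite [RHS]gK; apply: eq_bigr => i _; rewrite (coord_sum _ cf).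
have linF : linear F.
  move=> c x y; rewrite /F scaler_sumr -big_split; apply: eq_bigr => i _ /=.
  by rewrite lf scalerDl scalerA.
have F0 : F 0 = 0 by have := linF (-1) 0 0; rewrite !scaleN1r !addNr.
have FD x y : F (x + y) = F x + F y.
  by have := linF 1 x y; rewrite !scale1r.
have FZ c x : F (c *: x) = c *: F x by have := linF c x 0; rewrite F0 !addr0.
have Fsum (J : finType) (h : J -> A) : F (\sum_j h j) = \sum_j F (h j).
  exact: (big_morph F FD F0).
have Fa i : F (a i) = b i.
  rewrite /F (bigD1 i) //= fa eqxx scale1r big1 ?addr0 // => j ji.
  by rewrite fa eq_sym (negPf ji) scale0r.
have FM x y : F (x ** y) = F x ** F y.
  rewrite [in LHS](fK x) [in LHS](fK y) amul_suml Fsum amul_suml.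
  apply: eq_bigr => i _; rewrite amul_sumr Fsum amul_sumr.
  apply: eq_bigr => j _; rewrite !amulZl !amulZr !FZ; do 2!congr (_ *: _).
  by rewrite am bm; case: (m i j).
have F1 : F aone = aone by rewrite -[LHS]amula1 -{1}(GK aone) -FM amul1 GK.
by exists F => //; exists G.
Qed.

Lemma has_table_reindex (A : kalgType k) (I J : finType)
    (m : J -> J -> option J) (m' : I -> I -> option I) (h : I -> J) :
  bijective h -> (forall i j, m (h i) (h j) = omap h (m' i j)) ->
  has_table A m -> has_table A m'.
Proof.
move=> hbij hm [b [[f [lf fb fK]] bm]]; exists (b \o h); split.
  exists (fun x i => f x (h i)); split=> [i|i j|x]; first exact: lf.
    by rewrite fb (inj_eq (bij_inj hbij)).
  by rewrite {1}(fK x) (reindex h) //; apply: onW_bij.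
by move=> i j; rewrite /= bm hm; case: (m' i j).
Qed.

Definition sum_table (I J : finType) (m : I -> I -> option I)
    (m' : J -> J -> option J) (p q : I + J) : option (I + J) :=
  match p, q with
  | inl i, inl j => omap inl (m i j)
  | inr i, inr j => omap inr (m' i j)
  | _, _ => None
  end.

Lemma has_table_prod (A B : kalgType k) (I J : finType)
    (m : I -> I -> option I) (m' : J -> J -> option J) :
  has_table A m -> has_table B m' -> has_table (A * B)%type (sum_table m m').
Proof.
move=> [a [[f [lf fa fK]] am]] [b [[g [lg gb gK]] bm]].
have f0 i : f 0 i = 0 := scalar0 (lf i).
have g0 i : g 0 i = 0 := scalar0 (lg i).
exists (fun p => match p with inl i => (a i, 0) | inr j => (0, b j) end); split.
  exists (fun x p => match p with inl i => f x.1 i | inr j => g x.2 j end).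
  split=> [[i|j] c x y|[i|i] [j|j]|x] //=; rewrite ?(lf, lg, fa, gb) //.
  rewrite big_sumType /=; case: x => x y /=.
  have pairE (I' : finType) (F : I' -> A * B) :
      \sum_i F i = (\sum_i (F i).1, \sum_i (F i).2).
    by apply: (big_rec3 (fun u v w => w = (u, v))) => // i u v w _ ->.
  rewrite !pairE /=; congr pair => /=.
    by rewrite [X in _ + X]big1 ?addr0 => [|j _]; rewrite ?scaler0 //; apply: fK.
  by rewrite [X in X + _]big1 ?add0r => [|j _]; rewrite ?scaler0 //; apply: gK.
move=> [i|i] [j|j]; rewrite /amul /= /prod_amul /= ?amul0l ?amul0r ?am ?bm //.
  by case: (m i j).
by case: (m' i j).
Qed.

Definition power_table (X I : finType) (m : I -> I -> option I)
    (p q : X * I) : option (X * I) :=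
  if p.1 == q.1 then omap (pair p.1) (m p.2 q.2) else None.

Lemma has_table_ffun (X : finType) (A : kalgType k) (I : finType)
    (m : I -> I -> option I) :
  has_table A m -> has_table {ffun X -> A} (@power_table X I m).
Proof.
move=> [a [[f [lf fa fK]] am]].
have f0 i : f 0 i = 0 := scalar0 (lf i).
exists (fun p : X * I => [ffun x => if x == p.1 then a p.2 else 0]); split.
  exists (fun (u : {ffun X -> A}) p => f (u p.1) p.2).
  split=> [[x i] c u v|[x i] [y j]|u] /=.
  - by rewrite !ffunE lf.
  - by rewrite ffunE xpair_eqE eq_sym /=; case: eqP => _ /=; rewrite ?fa ?f0.
  apply/ffunP=> x; rewrite sum_ffunE [LHS]fK.
  rewrite -(pair_bigA _ (fun y i =>
    (f (u y) i *: [ffun z => if z == y then a i else 0] : {ffun X -> A}) x)) /=.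
  rewrite (bigD1 x) //= [X in _ + X]big1 ?addr0 => [|y yx].
    by apply: eq_bigr => i _; rewrite !ffunE eqxx.
  by apply: big1 => i _; rewrite !ffunE eq_sym (negPf yx) scaler0.
move=> [x i] [y j]; apply/ffunP=> z; rewrite ffunE !ffunE /= /power_table /=.
have [->|zx] := eqVneq z x; last first.
  rewrite amul0l; case: ifP => _; last by rewrite ffunE.
  by case: (m i j) => [l|] /=; rewrite ffunE // (negPf zx).
have [_|_] := eqVneq x y; last by rewrite amul0r ffunE.
by rewrite am; case: (m i j) => [l|] /=; rewrite ffunE ?eqxx.
Qed.

Definition matrix_table n (p q : 'I_n * 'I_n) : option ('I_n * 'I_n) :=
  if p.2 == q.1 then Some (p.1, q.2) else None.

Lemma has_table_matrix n : has_table 'M[k]_n (@matrix_table n).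
Proof.
exists (fun p => delta_mx p.1 p.2); split.
  exists (fun (M : 'M[k]_n) p => M p.1 p.2); split=> [p c x y|[i j] [i' j']|M] /=.
  - by rewrite !mxE.
  - by rewrite mxE xpair_eqE eq_sym (eq_sym j').
  rewrite {1}(matrix_sum_delta M).
  by rewrite (pair_bigA _ (fun i j => M i j *: delta_mx i j)).
move=> [i j] [i' j'] /=; rewrite /amul /= mul_delta_mx_cond /matrix_table /=.
by case: eqP.
Qed.

End Tables.

(** * The table of a radical square zero path algebra *)

Section ShortPaths.
Variables (k : fieldType) (Q : quiver).
Local Notation kQ := (path_algebra k Q).

Definition quiver_table (s t : vertex Q + arrow Q) :
    option (vertex Q + arrow Q) :=
  match s, t with
  | inl v, inl w => if v == w then Some s else None
  | inl v, inr a => if v == source a then Some t else None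
  | inr a, inl v => if target a == v then Some s else None
  | inr _, inr _ => None
  end.

Fact arrow_walk (a : arrow Q) : is_walk (source a) [:: a].
Proof. by rewrite /= eqxx. Qed.

Definition parrow (a : arrow Q) : qpath Q :=
  exist (fun x => is_walk x.1 x.2) (source a, [:: a]) (arrow_walk a).

Definition short_path (s : vertex Q + arrow Q) : qpath Q :=
  match s with inl v => ptriv v | inr a => parrow a end.

Lemma qpath_eqE (p q : qpath Q) :
  (p == q) = (psource p == psource q) && (parrows p == parrows q).
Proof.
apply/eqP/andP=> [->|[/eqP vE /eqP aE]]; first by rewrite !eqxx.
exact: qpath_eq.
Qed.

Lemma short_pathP (p : qpath Q) :
  (exists s, p = short_path s) \/ (2 <= plength p)%N.
Proof.
case: p => [[v [|a [|b s]]] /= w]; last by right.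
  by left; exists (inl v); apply: qpath_eq.
have /andP[/eqP va _] := w.
by left; exists (inr a); apply: qpath_eq; rewrite /psource //= va.
Qed.

Lemma short_path_inj : injective short_path.
Proof.
move=> [v|a] [w|b] /eqP; rewrite qpath_eqE /= ?andbF //.
  by rewrite andbT /psource /= => /eqP->.
by rewrite /parrows /= => /andP[_ /eqP[->]].
Qed.

(** These coefficients will be the coordinates on the quotient by the long
paths. *)
Definition short_coef (x : kQ) (s : vertex Q + arrow Q) : k :=
  x@_(short_path s).

Lemma short_coef_scalar s : scalar (short_coef^~ s).
Proof. by move=> c x y; rewrite /short_coef mcoeffD mcoeffZ. Qed.

Lemma short_coefU p s : short_coef (path_elt k p) s = (p == short_path s)%:R.
Proof. by rewrite /short_coef path_eltE mcoeffU. Qed.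

Lemma path_bilinear_ext (f g : kQ -> kQ -> k) :
    (forall x, scalar (f x)) -> (forall y, scalar (f^~ y)) ->
    (forall x, scalar (g x)) -> (forall y, scalar (g^~ y)) ->
    (forall p q, f (path_elt k p) (path_elt k q)
               = g (path_elt k p) (path_elt k q)) ->
  forall x y, f x y = g x y.
Proof.
move=> fr fl gr gl fg x y; move: x.
apply: (@path_ext k Q k^o (f^~ y) (g^~ y)) => // p; move: y.
exact: (@path_ext k Q k^o (f _) (g _)).
Qed.

(** A path of length at most one factors only through paths of length at most
one, so the short coefficients of a product depend only on those of the
factors. Hence the elements with vanishing short coefficients form an ideal. *)
Lemma short_coefM (x y : kQ) s :
  short_coef (x ** y) s =
    match s with
    | inl v => short_coef x (inl v) * short_coef y (inl v)
    | inr a => short_coef x (inl (source a)) * short_coef y (inr a)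
             + short_coef x (inr a) * short_coef y (inl (target a))
    end.
Proof.
move: x y; apply: path_bilinear_ext.
- by move=> x c y1 y2; rewrite amul_linearr short_coef_scalar.
- by move=> y c x1 x2; rewrite amul_linearl short_coef_scalar.
- move=> x c y1 y2; case: s => [v|a]; rewrite !short_coef_scalar.
    by rewrite !mulrDr !mulrA (mulrC c).
  by rewrite !mulrDr !mulrA !(mulrC c) addrACA.
- move=> y c x1 x2; case: s => [v|a]; rewrite !short_coef_scalar.
    by rewrite !mulrDl !mulrA.
  by rewrite !mulrDl mulrDr !mulrA addrACA.
move=> p q; rewrite /amul /= path_mulUU /pathU_mul.
have -> : short_coef (oapp (@path_elt k Q) 0 (Defs.pcomp p q)) s =
          (oapp (eq_op^~ (short_path s)) false (Defs.pcomp p q))%:R.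
  case: (Defs.pcomp p q) => [r|] /=; first exact: short_coefU.
  by rewrite /short_coef mcoeff0.
transitivity ((match s with
    | inl v => (p == ptriv v) && (q == ptriv v)
    | inr a => (p == ptriv (source a)) && (q == parrow a)
            || (p == parrow a) && (q == ptriv (target a))
    end : bool)%:R : k); last first.
  case: s => [v|a]; rewrite !short_coefU -!natrM !mulnb //= -natrD.
  congr _%:R; have [->|_] := eqVneq p (ptriv (source a)) => //=.
  have -> : (ptriv (source a) == parrow a) = false by rewrite qpath_eqE andbF.
  by rewrite orbF addn0.
apply: (congr1 (fun b : bool => b%:R)).
have [tv ta] : (forall v : vertex Q, psource (ptriv v) = v) *
    (forall v : vertex Q, parrows (ptriv v) = [::]) by [].
have [av aa] : (forall a : arrow Q, psource (parrow a) = source a) *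
    (forall a : arrow Q, parrows (parrow a) = [:: a]) by [].
(* Once p and q are replaced by their sources and lists of arrows, what
   remains compares a concatenation with a list of at most one arrow. *)
case: s => [w|a]; case: pcompP => [r e vr _ ar|e] /=;
  rewrite !qpath_eqE ?vr ?ar ?(tv, ta, av, aa) /=; move: e;
  rewrite /ptarget /walk_end;
  move: (psource p) (parrows p) (psource q) (parrows q) => v s1 u s2.
- by case: s1 => [|b s1] //= <-; rewrite ?andbF // andbT andbA andbb.
- case: s1 => [|b s1] //= e; rewrite ?andbF // andbT.
  have [vw|//] := eqVneq v w; have [uw|//] := eqVneq u w.
  by case: e; rewrite vw.
- case: s1 => [|b [|c s1]] /= <-; rewrite ?eqseq_cons ?andbF //=.
    by rewrite orbF andbT andbA andbb.
  rewrite !andbT; have [->|_] := eqVneq b a.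
    by rewrite eqxx andbT.
  by rewrite !andbF.
case: s1 => [|b [|c s1]] //= e; rewrite ?eqseq_cons ?andbF ?andbT ?orbF //.
  have [vw|//] := eqVneq v (source a); have [uw|//] := eqVneq u (source a).
  by case: e; rewrite vw.
have [ba|_] := eqVneq b a; rewrite ?andbF // andbT.
by have [ut|_] := eqVneq u (target a); rewrite ?andbF //; case: e; rewrite ba.
Qed.

Local Notation Q2 := (quotient_algebra (@long_path k Q)).

(** Long paths have no short coefficient, and by [short_coefM] the same holds
for the ideal that they generate: no relation is imposed on short paths. *)
Lemma short_coef_long x : x \in ideal_gen (@long_path k Q) ->
  short_coef x =1 (fun=> 0).
Proof.
move/ideal_genP=> /(_ (fun y => short_coef y =1 fun=> 0)); apply.
  split=> [s|x1 x2 x10 x20 s|a x1 b x10 s].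
  - by rewrite /short_coef mcoeff0.
  - by rewrite /short_coef mcoeffD [_@__]x10 [_@__]x20 addr0.
  by rewrite !short_coefM; case: s => [v|c]; rewrite !short_coefM !x10;
    rewrite !(mulr0, mul0r, addr0).
move=> y [p lp ->] s; rewrite short_coefU; case: eqP => // ps.
by move: lp; rewrite ps; case: (s).
Qed.

Lemma pi_linear : linear (\pi_Q2 : kQ -> Q2).
Proof.
move=> c x y; rewrite -[c *: \pi_Q2 x]/(quot_scale c _).
by rewrite pi_quot_scale pi_quot_add.
Qed.

Lemma pi_short_coef (x : kQ) :
  \pi_Q2 x = \sum_s short_coef x s *: \pi_Q2 (path_elt k (short_path s)).
Proof.
move: x; apply: (@path_ext k Q Q2 (fun x => \pi_Q2 x) (fun x =>
  \sum_s short_coef x s *: \pi_Q2 (path_elt k (short_path s)))) => [||p].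
- exact: pi_linear.
- move=> c x y; rewrite scaler_sumr -big_split; apply: eq_bigr => s _ /=.
  by rewrite short_coef_scalar scalerDl scalerA.
have [[s ->]|lp] := short_pathP p.
  rewrite (bigD1 s) //= short_coefU eqxx scale1r big1 ?addr0 // => t ts.
  by rewrite short_coefU (inj_eq short_path_inj) eq_sym (negPf ts) scale0r.
have lpI : path_elt k p \in ideal_gen (@long_path k Q).
  by apply/ideal_genP=> J _; apply; exists p.
rewrite big1 => [|s _]; last by rewrite (short_coef_long lpI) scale0r.
have /eqP -> : \pi_Q2 (path_elt k p) == \pi_Q2 0 by rewrite pi_eq subr0.
by have := pi_linear (-1) 0 0; rewrite !scaleN1r !addNr.
Qed.

Lemma has_table_path_algebra_lt2 :
  has_table (path_algebra_lt2 k Q) quiver_table.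
Proof.
have coefK x : short_coef (repr (\pi_Q2 x)) =1 short_coef x.
  move=> s; apply/eqP; rewrite -subr_eq0 -mcoeffB; apply/eqP.
  by apply: short_coef_long; rewrite -pi_eq reprK.
have [ll rr lr rl] : [/\
    forall v w, (inl v == inl w :> vertex Q + arrow Q) = (v == w),
    forall a b, (inr a == inr b :> vertex Q + arrow Q) = (a == b),
    forall (v : vertex Q) (b : arrow Q), (inl v == inr b) = false &
    forall (v : vertex Q) (b : arrow Q), (inr b == inl v) = false] by [].
exists (fun s => \pi_Q2 (path_elt k (short_path s))); split.
  exists (fun x => short_coef (repr x)); split=> [s c u v|s t|x].
  - rewrite -[u]reprK -[v]reprK -[LHS]/(short_coef (repr (c *: _ + _ : Q2)) s).
    by rewrite -pi_linear !coefK short_coef_scalar.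
  - by rewrite coefK short_coefU (inj_eq short_path_inj).
  by rewrite -pi_short_coef reprK.
move=> s t; set x := path_elt k _; set y := path_elt k _.
transitivity (\pi_Q2 (x ** y)); first exact: pi_quot_mul.
have coef_xy r : short_coef (x ** y) r =
    (oapp (eq_op^~ r) false (quiver_table s t))%:R.
  rewrite short_coefM /x /y.
  case: r => [u|c]; rewrite !short_coefU !(inj_eq short_path_inj);
    case: s t {x y} => [v|a] [w|b];
    rewrite ?(ll, rr, lr, rl) -!natrM -?natrD !mulnb ?andbF ?addn0 ?add0n /=
            ?eqxx //; try by case: ifP.
  - have [<-|vw] := eqVneq v w; first by rewrite andbb /= ll.
    by have [vu|//] := eqVneq v u; rewrite -vu eq_sym (negPf vw).
  - have [->|bc] := eqVneq b c; first by case: eqP; rewrite //= rr eqxx.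
    by rewrite andbF; case: eqP; rewrite //= rr (negPf bc).
  have [->|ac] := eqVneq a c; last first.
    by case: (target a == w); rewrite //= rr (negPf ac).
  by rewrite eq_sym; case: (_ == w); rewrite //= rr eqxx.
rewrite pi_short_coef; under eq_bigr do rewrite coef_xy.
case: (quiver_table s t) => [r|] /=; last first.
  by apply: big1 => r _; rewrite scale0r.
rewrite (bigD1 r) //= eqxx scale1r big1 ?addr0 // => r' rr'.
by rewrite eq_sym (negPf rr') scale0r.
Qed.

End ShortPaths.

(** * The table of a twisted product *)

Section BasisChange.
Variables (k : fieldType) (V : lmodType k) (I : finType).

Lemma big_pair_bool (h : I * bool -> V) :
  \sum_p h p = \sum_i (h (i, true) + h (i, false)).
Proof.
rewrite (eq_bigr (fun p => h (p.1, p.2))) => [|[] //].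
rewrite -(pair_bigA _ (fun i t => h (i, t))) /=.
by apply: eq_bigr => i _; rewrite big_bool.
Qed.

(** The passage from the basis e_i, e_i y to the one that is closed under
multiplication; it only mixes the two vectors with the same index i. *)
Lemma coordinates_triangular (b b' : I * bool -> V) f (c l r : I -> k) :
    coordinates b f -> (forall i, l i != 0) ->
    (forall i, b' (i, true) = l i *: (b (i, true) + c i *: b (i, false))) ->
    (forall i, b' (i, false) = b (i, false) - r i *: b' (i, true)) ->
  exists f', coordinates b' f'.
Proof.
move=> [lf fb fK] l0 b't b'f.
have f0 p : f 0 p = 0 := scalar0 (lf p).
have fD x y p : f (x + y) p = f x p + f y p.
  by have := lf p 1 x y; rewrite scale1r mul1r.
have fZ a x p : f (a *: x) p = a * f x p.
  by have := lf p a x 0; rewrite addr0 f0 addr0.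
have fN x p : f (- x) p = - f x p by rewrite -scaleN1r fZ mulN1r.
exists (fun x p => let d := f x (p.1, false) - c p.1 * f x (p.1, true) in
  if p.2 then (l p.1)^-1 * f x (p.1, true) + r p.1 * d else d).
split=> [[i []] a x y|[i t] [j u]|x] /=.
- by rewrite !lf; ring.
- by rewrite !lf; ring.
- have fbt u' : f (b (i, true)) (j, u') = ((i == j) && u')%:R.
    by rewrite fb xpair_eqE; case: u'.
  have fbf u' : f (b (i, false)) (j, u') = ((i == j) && ~~ u')%:R.
    by rewrite fb xpair_eqE; case: u'.
  rewrite xpair_eqE; case: t u => [] []; rewrite ?b'f ?fD ?fN ?fZ b't;
    rewrite ?fD ?fN ?fZ ?fD ?fZ !fbt !fbf /=;
    have [<-|_] /= := eqVneq i j; try (by ring); try by field.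
rewrite {1}(fK x) !big_pair_bool; apply: eq_bigr => i _ /=; rewrite b'f.
set d := _ - _; rewrite scalerDl -addrA scalerBr !scalerA [d * _]mulrC.
rewrite [X in _ = _ + X]addrCA subrr addr0 b't !scalerA.
rewrite mulrAC mulVf // mul1r scalerDr scalerA -addrA -scalerDl.
by congr (_ + _ *: _); rewrite /d; ring.
Qed.

End BasisChange.

(** For every i there are two basis vectors. If [F i], the vertex i splits and
both vectors are idempotents, the vertices (i, false) and (i, true). Otherwise
(i, false) is the vertex and (i, true) an arrow that starts there; it ends at
(s i, S i), so [S] selects one of the vertices over s i. Two arrows have product
zero, except when they run back and forth between i and s i with [M i]: then
they behave as the matrix units E_01 and E_10. *)
Definition twisted_table n (s : 'I_n -> 'I_n) (M F S : pred 'I_n)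
    (p q : 'I_n * bool) : option ('I_n * bool) :=
  let arrow (r : 'I_n * bool) := r.2 && ~~ F r.1 in
  if arrow p then
    if arrow q then if M p.1 && (q.1 == s p.1) then Some (p.1, false) else None
    else if q == (s p.1, S p.1) then Some p else None
  else if p == (if arrow q then (q.1, false) else q) then Some q else None.

(** The pairs {i, s i} with [M i] are the matrix blocks; [matched_isolated] says
that no arrow enters a block from outside. *)
Record twisted_shape n (s : 'I_n -> 'I_n) (M F S : pred 'I_n) : Prop :=
  TwistedShape {
    matched_swap : forall i, M i -> [/\ s (s i) = i, s i != i & M (s i)];
    matched_isolated : forall i, M (s i) -> M i;
    split_fixed : forall i, F i -> s i = i;
    select_split : forall i, S i -> F (s i) }.

Section TwistedBasis.
Variables (k : fieldType) (T : kalgType k) (n : nat).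
Variables (e : 'I_n -> T) (y : T) (g : k) (f : T -> 'I_n * bool -> k).
Hypothesis eM : forall i j, e i ** e j = (i == j)%:R *: e i.
Hypothesis e1 : \sum_i e i = aone.
Hypothesis yy : y ** y = g *: y.
Hypothesis fP : coordinates (fun q => if q.2 then e q.1 ** y else e q.1) f.

Let ey_inj i a b a' b' :
  a *: e i + b *: (e i ** y) = a' *: e i + b' *: (e i ** y) ->
  a = a' /\ b = b'.
Proof.
have [lf fb _] := fP.
have f0 p : f 0 p = 0 := scalar0 (lf p).
have fE u v t : f (u *: e i + v *: (e i ** y)) (i, t) = if t then v else u.
  rewrite lf -[v *: _]addr0 lf f0 addr0.
  rewrite (fb (i, false)) (fb (i, true)) !xpair_eqE eqxx.
  by case: t; rewrite !(mulr0, mulr1, addr0, add0r).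
by move=> E; split; [rewrite -(fE a b false) E fE | rewrite -(fE a b true) E fE].
Qed.

(** The relation (e_i y e_j) e_l = [j = l] e_i y e_j makes the coefficients of
e_i y orthogonal idempotents, and their sum is 1 because the e_j sum to 1; the
coefficients of e_i are then constrained by c_i alone. When s i = i the
relation forces c_i = 0. *)
Lemma shift_exists : exists s : 'I_n -> 'I_n, exists c : 'I_n -> k,
  (forall i, s i = i -> c i = 0) /\
  (forall i j, (e i ** y + c i *: e i) ** e j =
               (j == s i)%:R *: (e i ** y + c i *: e i)).
Proof.
pose d i j := f (y ** e j) (i, false); pose a i j := f (y ** e j) (i, true).
have eye i j : e i ** y ** e j = d i j *: e i + a i j *: (e i ** y).
  have [_ _ fK] := fP; rewrite -amulA {1}(fK (y ** e j)) amul_sumr.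
  rewrite (eq_bigr (fun q => (i == q.1)%:R *: (f (y ** e j) q *:
      (if q.2 then e q.1 ** y else e q.1)))) => [|[l t] _ /=]; last first.
    rewrite amulZr; case: t; rewrite ?amulA eM ?amulZl !scalerA mulrC -!scalerA;
      have [->|_] := eqVneq i l; by rewrite ?scale0r.
  rewrite big_pair_bool (bigD1 i) //= big1 ?addr0 => [|l li]; last first.
    by rewrite eq_sym (negPf li) !scale0r addr0.
  by rewrite eqxx !scale1r addrC.
(* e_i y e_j e_l in two ways, by the coefficients of e_i and of e_i y. *)
have eyee i j l : (j == l)%:R * d i j = d i j * (i == l)%:R + a i j * d i l /\
    (j == l)%:R * a i j = a i j * a i l.
  apply: (@ey_inj i); rewrite -!scalerA -scalerDr -eye.
  rewrite -[in LHS](amulZr) -eM amulA eye amulDl !amulZl eM eye.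
  by rewrite scalerDr !scalerA addrA -scalerDl.
have sum_eye i : \sum_j d i j = 0 /\ \sum_j a i j = 1.
  apply: (@ey_inj i); rewrite !scaler_suml -big_split /=.
  under eq_bigr do rewrite -eye.
  by rewrite -amul_sumr e1 amula1 scale0r scale1r add0r.
have ex_s i : exists j, a i j != 0.
  apply/existsP; apply: contraT; rewrite negb_exists => /forallP a0.
  have [_ ] := sum_eye i; rewrite big1 => [/eqP|j _].
    by rewrite eq_sym oner_eq0.
  by apply/eqP; have := a0 j; rewrite negbK.
pose s i := xchoose (ex_s i).
have as0 i : a i (s i) != 0 by apply: (xchooseP (ex_s i)).
have aE i j : a i j = (j == s i)%:R.
  have [_ E] := eyee i (s i) j; apply: (mulfI (as0 i)).
  by rewrite -E mulrC eq_sym.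
have dE i j : d i j = d i (s i) * ((j == s i)%:R - (j == i)%:R).
  have [+ _] := eyee i (s i) j; rewrite aE eqxx mul1r => E.
  by rewrite mulrBr [_ * (j == s i)%:R]mulrC eq_sym E [i == j]eq_sym; ring.
exists s, (fun i => d i (s i)); split=> [i si|i j].
  by rewrite dE si subrr mulr0.
rewrite amulDl amulZl eM eye aE dE [i == j]eq_sym scalerA addrAC -scalerDl.
by rewrite scalerDr scalerA addrC; congr (_ + _ *: _); ring.
Qed.

Variables (s : 'I_n -> 'I_n) (c : 'I_n -> k).
Hypothesis c0 : forall i, s i = i -> c i = 0.
Let w i := e i ** y + c i *: e i.
Hypothesis we : forall i j, w i ** e j = (j == s i)%:R *: w i.
Let u i := g + c i + c (s i).
Let v i := c i * (g + c i).

Let ew i j : e i ** w j = (i == j)%:R *: w j.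
Proof.
rewrite /w amulDr amulZr amulA !eM amulZl scalerDr scalerA mulrC -scalerA.
by have [->|_] := eqVneq i j; rewrite ?scale0r ?scaler0.
Qed.

(** Obtained from w_i y, with y^2 = g y and e_i y = w_i - c_i e_i. *)
Let ww i j : w i ** w j = (j == s i)%:R *: (u i *: w i - v i *: e i).
Proof.
have -> : w i ** w j = (j == s i)%:R *: (w i ** w j).
  have wE : w j = e j ** w j by rewrite ew eqxx scale1r.
  by rewrite [in LHS]wE amulA we amulZl.
have [->|_] := eqVneq j (s i); last by rewrite !scale0r.
congr (_ *: _); rewrite {2}/w amulDr amulA amulZr we eqxx scale1r.
rewrite {1}/w amulDl -amulA yy amulZr amulZl -scalerDl.
have -> : e i ** y = w i - c i *: e i by rewrite addrK.
by rewrite scalerBr scalerA addrAC -scalerDl /u /v [c i * _]mulrC.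
Qed.

Let we_eq0 i a b : a *: w i + b *: e i = 0 -> a = 0 /\ b = 0.
Proof.
rewrite /w scalerDr scalerA -addrA -scalerDl addrC => E.
have [] : a * c i + b = 0 /\ a = 0.
  by apply: (@ey_inj i); rewrite E !scale0r addr0.
by move=> + a0; rewrite a0 mul0r add0r.
Qed.

(** The two expansions of w_i w_(s i) e_l compared in the basis w_i, e_i. *)
Let wwe i l : u i * ((l == s i)%:R - (l == s (s i))%:R) = 0 /\
   v i * ((l == s (s i))%:R - (l == i)%:R) = 0.
Proof.
apply: (@we_eq0 i); have := amulA (w i) (w (s i)) (e l).
rewrite we amulZr ww eqxx scale1r amulBl !amulZl we eM => E.
rewrite !mulrBr !scalerBl.
rewrite -[RHS](subrr ((l == s (s i))%:R *: (u i *: w i - v i *: e i))) {1}E.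
rewrite scalerBr !scalerA opprB addrACA [RHS]addrACA; congr (_ + _ + _).
- by rewrite mulrC.
by rewrite addrC [l == i]eq_sym [u i * _]mulrC.
Qed.

Let ss_of_u i : u i != 0 -> s (s i) = s i.
Proof.
move=> u0; have [/eqP + _] := wwe i (s i).
rewrite eqxx mulf_eq0 (negPf u0) /=.
by have [|_] := eqVneq (s i) (s (s i)); rewrite // subr0 oner_eq0.
Qed.

Let ss_of_v i : v i != 0 -> s (s i) = i.
Proof.
move=> v0; have [_ /eqP] := wwe i i.
rewrite eqxx mulf_eq0 (negPf v0) /=.
by have [|_] := eqVneq i (s (s i)); rewrite // sub0r oppr_eq0 oner_eq0.
Qed.

Let s_neq i : v i != 0 -> s i != i.
Proof. by apply: contraNneq => /c0 ci; rewrite /v ci mul0r. Qed.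

Let u_of_ss i : s (s i) != s i -> u i = 0.
Proof. by move=> si; apply/eqP; apply: contraNT si => /ss_of_u->. Qed.

Let v_s i : v i != 0 -> v (s i) = v i.
Proof.
move=> vi; have := u_of_ss; move/(_ i); rewrite ss_of_v // eq_sym s_neq //.
move=> /(_ isT); rewrite /u /v => ui.
have -> : c (s i) = - (g + c i) by rewrite -[RHS]addr0 -ui; ring.
ring.
Qed.

(** If v_i = 0 while s i lies on a 2-cycle, then w_i w_(s i) = 0, and
multiplying once more by w_(s (s i)) leaves -v_(s i) w_i = 0. *)
Let v_isolated i : v (s i) != 0 -> v i != 0.
Proof.
move=> vsi; have sss := ss_of_v vsi; have ssi := s_neq vsi.
apply: contraTneq isT => vi.
have := amulA (w i) (w (s i)) (w (s (s i))).
rewrite !ww !eqxx !scale1r (u_of_ss ssi) vi !scale0r subr0 amul0l.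
rewrite u_of_ss; last by rewrite sss eq_sym.
rewrite scale0r sub0r -scaleNr amulZr we eqxx scale1r => E.
have [] := @we_eq0 i (- v (s i)) 0; first by rewrite scale0r addr0.
by move/eqP; rewrite oppr_eq0 (negPf vsi).
Qed.

(** The scalar [l] turns w_i into an idempotent when the vertex i splits. On a
matrix block only the arrow from the smaller index is rescaled, which is enough
to make the two arrows inverse to each other. *)
Let M i := v i != 0.
Let F i := (s i == i) && (g != 0).
Let S i := F (s i) && (u i != 0).
Let l i : k :=
  if F i then g^-1 else if M i && (i < s i)%N then - (v i)^-1 else 1.
Let b (p : 'I_n * bool) : T :=
  if p.2 then l p.1 *: w p.1
  else if F p.1 then e p.1 - l p.1 *: w p.1 else e p.1.

Let l_neq0 i : l i != 0.
Proof.
rewrite /l; case: ifP => [/andP[_ g0]|_]; first by rewrite invr_eq0.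
by case: ifP => [/andP[Mi _]|_]; rewrite ?oner_eq0 // oppr_eq0 invr_eq0.
Qed.

Let e_b i q : e i ** b q = (i == q.1)%:R *: b q.
Proof.
case: q => j t; rewrite /b /=.
have El : e i ** (l j *: w j) = (i == j)%:R *: (l j *: w j).
  by rewrite amulZr ew !scalerA mulrC.
have Ee : e i ** e j = (i == j)%:R *: e j.
  by rewrite eM; have [->|_] := eqVneq i j; rewrite ?scale0r.
by case: t => //; case: (F j); rewrite // amulBr El Ee scalerBr.
Qed.

(** An index i sent to a fixed point has v_i = c_i (g + c_i) = 0. So c_i is 0 or
-g, and u_i = g + c_i is g or 0 accordingly. *)
Let F_uv i : F (s i) -> u i = (S i)%:R * g /\ v i = 0.
Proof.
move=> Fsi; have /andP[/eqP ssi g0] := Fsi.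
have csi := c0 ssi.
have vi : v i = 0.
  apply/eqP/contraT => v0; have := s_neq v0.
  by have := ss_of_v v0; rewrite ssi => ->; rewrite eqxx.
split=> //; rewrite /S Fsi /=.
have [-> |u0] := eqVneq (u i) 0; first by rewrite mul0r.
move: vi u0; rewrite /v /u csi addr0 => /eqP.
by rewrite mulf_eq0 => /orP[/eqP->|->]//; rewrite addr0 mul1r.
Qed.

Let w_bf i j : w i ** b (j, false) = ((j, false) == (s i, S i))%:R *: w i.
Proof.
rewrite /b /= xpair_eqE; have [->|ji] := eqVneq j (s i); last first.
  by case: ifP => _;
    rewrite ?amulBr ?amulZr ?we ?ww (negPf ji) !scale0r ?scaler0 ?subr0.
case: ifP => [Fj|Fj]; last by rewrite we eqxx /S Fj.
have [ui vi] := F_uv Fj; have /andP[_ g0] := Fj.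
rewrite amulBr amulZr we ww eqxx !scale1r vi scale0r subr0 scalerA ui /l Fj.
rewrite mulrCA mulVf // mulr1 -{1}(scale1r (w i)) -scalerBl.
by case: (S i); rewrite ?subrr ?subr0.
Qed.

Let w_btF i j : F j -> w i ** b (j, true) = ((j, true) == (s i, S i))%:R *: w i.
Proof.
move=> Fj; rewrite /b /= xpair_eqE amulZr ww; have [ji|ji] := eqVneq j (s i).
  rewrite ji in Fj *; have [ui vi] := F_uv Fj; have /andP[_ g0] := Fj.
  rewrite scale1r vi scale0r subr0 scalerA ui /l Fj mulrCA mulVf // mulr1.
  by case: (S i).
by rewrite !scale0r scaler0.
Qed.

(** Here u_i = 0: otherwise s i is a fixed point that does not split, so that
g = 0, u_i = c_i and v_i = u_i^2; but v_i = 0 as i is not on a 2-cycle. *)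
Let w_bt i j :
  ~~ F j -> w i ** b (j, true) = (j == s i)%:R *: (- (v i * l j) *: e i).
Proof.
move=> Fj; rewrite /b /= amulZr ww; have [ji|_] := eqVneq j (s i).
  rewrite !scale1r; suff -> : u i = 0.
    by rewrite scale0r sub0r scalerN scalerA scaleNr mulrC.
  apply/eqP; apply: contraNT Fj => u0; have ss := ss_of_u u0.
  rewrite /F ji ss eqxx /=; apply: contraNneq u0 => g0.
  have: v i = 0.
    apply/eqP/contraT => v0; have := s_neq v0.
    by have := ss_of_v v0; rewrite ss => ->; rewrite eqxx.
  by rewrite /u /v g0 (c0 ss) !add0r addr0 => /eqP; rewrite mulf_eq0 orbb.
by rewrite !scale0r scaler0.
Qed.

Lemma has_table_twisted : exists s' (M' F' S' : pred 'I_n),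
  twisted_shape s' M' F' S' /\ has_table T (twisted_table s' M' F' S').
Proof.
exists s, M, F, S; split.
  split; first by move=> i Mi; split;
    [apply: ss_of_v | apply: s_neq | rewrite /M v_s].
  - exact: v_isolated.
  - by move=> i /andP[/eqP].
  by move=> i /andP[].
exists b; split.
  apply: (@coordinates_triangular k T 'I_n _ b f c l (fun i => (F i)%:R) fP).
  - exact: l_neq0.
  - by move=> i; rewrite /b /w addrC.
  by move=> i; rewrite /b /=; case: (F i); rewrite ?scale1r // scale0r subr0.
have M_F i : M i -> ~~ F i by move=> Mi; rewrite /F (negPf (s_neq Mi)).
(* One of l_i, l_(s i) is 1 and the other -1 / v_i. *)
have lM i : M i -> l i * (v i * l (s i)) = -1.
  move=> Mi; have Msi : M (s i) by rewrite /M v_s.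
  have ssi := ss_of_v Mi; have vi0 : v i != 0 := Mi.
  rewrite /l !(negPf (M_F _ _)) // Mi Msi ssi v_s //.
  have [_|_|/val_inj si] := ltngtP i (s i) => /=.
  - by rewrite mulr1 mulNr mulVf.
  - by rewrite mul1r mulrN mulfV.
  by move: (s_neq Mi); rewrite -si eqxx.
have oE (P : bool) p : oapp b 0 (if P then Some p else None) = P%:R *: b p.
  by case: P; rewrite ?scale1r ?scale0r.
move=> [i t] [j t']; rewrite /twisted_table /=.
(* At a split vertex b (i, true) is an idempotent and b (i, false) is its
   complement in e_i. *)
have [Fi|Fi] := boolP (F i); rewrite ?andbF ?andbT.
  rewrite oE; have /andP[/eqP si g0] := Fi.
  have Si : S i by rewrite /S si Fi /u si c0 // !addr0.
  have bib : b (i, true) ** b (j, t') =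
      ((i, true) == (if t' && ~~ F j then (j, false) else (j, t')))%:R
        *: b (j, t').
    rewrite [b (i, true)]/b /= amulZl; case: t' => /=; last first.
      by rewrite w_bf si Si !xpair_eqE !andbF !scale0r scaler0.
    have [Fj|Fj] := boolP (F j); rewrite /= xpair_eqE.
      rewrite w_btF // si Si xpair_eqE eq_sym.
      by have [->|_] := eqVneq i j; rewrite ?scale0r ?scaler0 //= !scale1r.
    rewrite w_bt // si andbF; have [ji|_] := eqVneq j i.
      by move: Fj; rewrite ji Fi.
    by rewrite !scale0r scaler0.
  case: t => //.
  have -> : b (i, false) = e i - b (i, true) by rewrite /b /= Fi.
  rewrite amulBl e_b bib {bib} -scalerBl /=; congr (_ *: _).
  by case: t' (F j) => [] [] /=; rewrite !xpair_eqE ?andbT ?andbF ?subr0 ?subrr.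
case: t => /=; last first.
  rewrite oE [b (i, false)]/b /= (negPf Fi) e_b; congr (_ *: _).
  case: t' => /=; last by rewrite xpair_eqE andbT.
  have [Fj|_] := boolP (F j); rewrite /= xpair_eqE ?andbT // andbF.
  by have [ij|] := eqVneq i j; rewrite // -ij (negPf Fi) in Fj.
rewrite [b (i, true)]/b /= amulZl; case: t' => /=; last first.
  by rewrite w_bf oE !scalerA mulrC.
have [Fj|Fj] := boolP (F j); first by rewrite w_btF // oE !scalerA mulrC.
rewrite w_bt // oE [b (i, false)]/b /= (negPf Fi).
have [->|_] := eqVneq j (s i); last by rewrite andbF !scale0r scaler0.
rewrite andbT scale1r scalerA mulrN; congr (_ *: _).
have [Mi|] := boolP (M i); first by rewrite lM // opprK.
by rewrite negbK => /eqP->; rewrite mul0r mulr0 oppr0.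
Qed.

End TwistedBasis.

(** * Matching the tables *)

Section Recognition.
Variables (n : nat) (s : 'I_n -> 'I_n) (M F S : pred 'I_n).
Hypothesis shape : twisted_shape s M F S.

Let table := twisted_table s M F S.
Let is_arrow (p : 'I_n * bool) := p.2 && ~~ F p.1.

Let Ms i : M (s i) = M i.
Proof.
by apply/idP/idP=> [/(matched_isolated shape)|/(matched_swap shape)[]].
Qed.

Let MF i : M i -> F i = false.
Proof.
case/(matched_swap shape)=> _ si _.
by apply: contraNF si => /(split_fixed shape)->.
Qed.

(** Products of a vector of a matrix block with one outside vanish. *)
Let table_M p q : M p.1 != M q.1 -> table p q = None.
Proof.
move=> pq; rewrite /table /twisted_table.
case: ifP => _; last first.
  by case: eqP => // E; move: pq; rewrite E; case: (_ && _); rewrite eqxx.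
case: ifP => _.
  by case: andP => // -[_ /eqP E]; move: pq; rewrite E Ms eqxx.
by case: eqP => // E; move: pq; rewrite E Ms eqxx.
Qed.

Definition is_quiver_vertex :=
  [pred p : 'I_n * bool | ~~ is_arrow p && ~~ M p.1].
Definition is_quiver_arrow :=
  [pred p : 'I_n * bool | is_arrow p && ~~ M p.1].

Fact source_proof (a : {p | is_quiver_arrow p}) :
  is_quiver_vertex ((val a).1, false).
Proof. by case: a => -[i t] /= /andP[]. Qed.

Fact target_proof (a : {p | is_quiver_arrow p}) :
  is_quiver_vertex (s (val a).1, S (val a).1).
Proof.
case: a => -[i t] /= /andP[_ Mi]; rewrite Ms Mi andbT /is_arrow /=.
by apply/negP=> /andP[/(select_split shape)->].
Qed.

Definition twisted_quiver : quiver := {|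
  vertex := {p | is_quiver_vertex p}; arrow := {p | is_quiver_arrow p};
  source a := exist (fun p => is_quiver_vertex p) _ (source_proof a);
  target a := exist (fun p => is_quiver_vertex p) _ (target_proof a) |}.
Local Notation Q := twisted_quiver.

(** A matrix block is represented by the smaller of its two indices; [r m a] is
the row number a of the block m, so that s exchanges the rows of a block. *)
Let P := [pred i : 'I_n | M i && (i < s i)%N].
Local Notation t := #|P|.

Let rep (m : 'I_t) : 'I_n := enum_val (A := P) m.
Let r (m : 'I_t) (a : 'I_2) := if a == 0 then rep m else s (rep m).

Let val_P m : M (rep m) /\ (rep m < s (rep m))%N.
Proof. by apply/andP; have := enum_valP (A := P) m; rewrite inE. Qed.

Let r_M m a : M (r m a).
Proof. by rewrite /r; have [Mm _] := val_P m; case: ifP => _; rewrite ?Ms. Qed.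

Let I2P (a : 'I_2) : (a = 0) + (a = 1).
Proof. by case: a => [[|[|//]] ia]; [left|right]; apply: val_inj. Qed.

Let r_s m a : s (r m a) = r m (rev_ord a).
Proof.
have [/(matched_swap shape)[ss _ _] _] := val_P m.
have [e0 e1] : rev_ord (0 : 'I_2) = 1 /\ rev_ord (1 : 'I_2) = 0.
  by split; apply: val_inj.
by case: (I2P a) => ->; rewrite ?e0 ?e1 /r /= ?ss.
Qed.

Let r_inj m m' a a' : (r m a == r m' a') = (m == m') && (a == a').
Proof.
have [/(matched_swap shape)[ss _ _] lt1] := val_P m.
have [/(matched_swap shape)[ss' _ _] lt2] := val_P m'.
case: (I2P a) => ->; case: (I2P a') => ->; rewrite /r /= ?andbT ?andbF.
- by rewrite (inj_eq enum_val_inj).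
- by apply/eqP=> E; move: lt1; rewrite E ss' ltnNge ltnW.
- by apply/eqP=> E; move: lt2; rewrite -E ss ltnNge ltnW.
apply/eqP/eqP=> [E|->//]; apply: enum_val_inj.
by rewrite -/(rep m) -/(rep m') -ss E ss'.
Qed.

(** The matrix unit E_ab of a block sits in row a: it is the vertex of that row
if a = b and its arrow to the other row otherwise. *)
Definition table_index (x : ('I_t * ('I_2 * 'I_2)) + (vertex Q + arrow Q)) :
    'I_n * bool :=
  match x with
  | inl (m, (a, b)) => (r m a, a != b)
  | inr (inl v) => val v
  | inr (inr a) => val a
  end.

Let index_M x : M (table_index x).1 = if x is inl _ then true else false.
Proof.
case: x => [[m [a b]]|[v|a]] /=; first exact: r_M.
  by case/andP: (valP v) => _ /negPf.
by case/andP: (valP a) => _ /negPf.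
Qed.

Let index_arrow z :
  is_arrow (table_index (inr z)) = if z is inr _ then true else false.
Proof.
case: z => [v|a] /=; first by case/andP: (valP v) => /negPf.
by case/andP: (valP a).
Qed.

Lemma table_index_bij : bijective table_index.
Proof.
have inj : injective table_index.
  move=> x y E; have := congr1 (fun p => M p.1) E; rewrite /= !index_M.
  case: x y E => [[m [a b]]|z] [[m' [a' b']]|z'] //.
    move=> /= [/eqP]; rewrite r_inj => /andP[/eqP-> /eqP->].
    by case: (I2P a') => ->; case: (I2P b) => ->; case: (I2P b') => ->.
  move=> E _; congr inr; have := congr1 is_arrow E; rewrite !index_arrow.
  by case: z z' E => [v|a] [v'|a'] //= /val_inj->.
have surj p : exists x, table_index x == p.
  have [Mp|Mp] := boolP (M p.1).
    have [m [a ->]] : exists m a, p = (r m a, p.2).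
      have [ss sp Msp] := matched_swap shape Mp.
      case: p Mp ss sp Msp => i u /= Mi ss si Msi.
      have [lt|gt|/val_inj E] := ltngtP i (s i).
      - have Pi : i \in P by rewrite inE Mi.
        by exists (enum_rank_in Pi i), 0; rewrite /r /= /rep enum_rankK_in.
      - have Pi : s i \in P by rewrite inE Msi ss.
        exists (enum_rank_in Pi (s i)), 1.
        by rewrite /r /= /rep enum_rankK_in ?ss.
      by rewrite -E eqxx in si.
    exists (inl (m, (a, if p.2 then rev_ord a else a))) => /=; apply/eqP.
    by congr pair; case: (p.2); case: (I2P a) => ->.
  case pa: (is_arrow p).
    have ap : is_quiver_arrow p by rewrite /= pa.
    by exists (inr (inr (exist (fun p => is_quiver_arrow p) p ap))) => /=.
  have vp : is_quiver_vertex p by rewrite /= pa.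
  by exists (inr (inl (exist (fun p => is_quiver_vertex p) p vp))) => /=.
have surjK p : table_index (xchoose (surj p)) = p.
  by apply/eqP; apply: (xchooseP (surj p)).
by exists (fun p => xchoose (surj p)) => // x; apply: inj; rewrite surjK.
Qed.

Lemma table_indexM x y :
  table (table_index x) (table_index y) = omap table_index
    (sum_table (@power_table 'I_t _ (@matrix_table 2)) (@quiver_table Q) x y).
Proof.
case: x => [[m [a b]]|x]; case: y => [[m' [a' b']]|z].
- rewrite /= /power_table /matrix_table /= /table /twisted_table /=.
  rewrite !MF ?r_M // !andbT r_s !xpair_eqE ?r_inj.
  have -> : S (r m a) = false.
    apply: contraTF (r_M m a) => /(select_split shape).
    by apply: contraL => Ma; rewrite MF ?Ms.
  have [e0 e1] : rev_ord (0 : 'I_2) = 1 /\ rev_ord (1 : 'I_2) = 0.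
    by split; apply: val_inj.
  rewrite [m' == m]eq_sym; have [<-|mm'] := eqVneq m m'.
    by case: (I2P a) => ->; case: (I2P b) => ->; case: (I2P a') => ->;
       case: (I2P b') => ->; rewrite ?e0 ?e1 /= ?xpair_eqE ?r_inj ?eqxx.
  by case: (a != b) (a' != b') => [] [] //=; rewrite xpair_eqE r_inj (negPf mm').
- have -> : table (table_index (inl (m, (a, b)))) (table_index (inr z)) = None.
    by apply: table_M; rewrite !index_M.
  by case: z.
- have -> : table (table_index (inr x)) (table_index (inl (m', (a', b')))) = None.
    by apply: table_M; rewrite !index_M.
  by case: x.
rewrite /table /twisted_table -/(is_arrow (table_index (inr x))).
rewrite -/(is_arrow (table_index (inr z))) !index_arrow.
have negM a : M (val (a : arrow Q)).1 = false.
  by case/andP: (valP a) => _ /negPf.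
case: x z => [v|a] [v'|a'] /=; rewrite ?negM //.
- by rewrite (inj_eq val_inj); have [->|//] := eqVneq v v'.
- by rewrite -[v == source a'](inj_eq val_inj) /=; case: eqP.
by rewrite eq_sym -[target a == v'](inj_eq val_inj) /=; case: eqP.
Qed.

End Recognition.

Lemma twisted_table_isog (k : fieldType) (T : kalgType k) n
    (s : 'I_n -> 'I_n) (M F S : pred 'I_n) :
    twisted_shape s M F S -> has_table T (twisted_table s M F S) ->
  exists (t : nat) (Q : quiver),
    kalg_isog T ({ffun 'I_t -> 'M[k]_2} * path_algebra_lt2 k Q)%type.
Proof.
move=> shape Tt.
exists #|[pred i : 'I_n | M i && (i < s i)%N]|, (twisted_quiver shape).
have blocks X := has_table_ffun X (has_table_matrix k 2).
have arrows := has_table_path_algebra_lt2 k (twisted_quiver shape).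
apply: (has_table_isog _ (has_table_prod (blocks _) arrows)).
apply: (has_table_reindex (table_index_bij shape) _ Tt).
exact: table_indexM.
Qed.

(** * The twisted products of the theorem *)

Section Quadratic.
Variables (k : fieldType) (p : {poly k}).
Hypotheses (p_monic : p \is monic) (p_deg2 : size p = 3%N).

Lemma quadratic_split : ~ irreducible_poly p ->
  exists a b, p = ('X - a%:P) * ('X - b%:P).
Proof.
move=> pN; have [a ra] : exists a, root p a.
  apply: contrapT => /forallNP nr; apply: pN; apply: cubic_irreducible.
    by rewrite p_deg2.
  by move=> x; apply/negP.
have [q pE] := factor_theorem p a ra.
have qm : q \is monic by rewrite -(monicMr _ (monicXsubC a)) -pE.
have sq : size q = 2%N.
  have := p_deg2; rewrite pE size_Mmonic ?monicXsubC ?monic_neq0 //.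
  by rewrite size_XsubC addn2 => -[].
exists a, (- q`_0); rewrite pE mulrC; congr (_ * _).
apply/polyP=> i; rewrite coefB coefX coefC.
case: i => [|[|i]] /=; rewrite ?sub0r ?subr0 ?opprK //.
  by have /monicP := qm; rewrite lead_coefE sq.
by rewrite oppr0 nth_default ?sq.
Qed.

(** The coordinates of q on 1 and X - a are its value at a and, its degree being
at most one, its linear coefficient. *)
Lemma qpoly_coordinates a b : p = ('X - a%:P) * ('X - b%:P) ->
  let z : {poly %/ p} := in_qpoly p ('X - a%:P) in
  z ** z = (b - a) *: z /\
  exists f, coordinates (fun t : bool => if t then z else aone : {poly %/ p}) f.
Proof.
move=> pE z; have mkp : mk_monic p = p by rewrite /mk_monic p_deg2 p_monic.
have small (q : {poly k}) : (size q < 3)%N -> in_qpoly p q = q :> {poly k}.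
  by move=> sq; rewrite in_qpoly_small // mkp p_deg2.
split.
  rewrite /amul /= -in_qpolyM -in_qpolyZ.
  have -> : ('X - a%:P) * ('X - a%:P) = (b - a) *: ('X - a%:P) + p.
    by rewrite pE -mul_polyC; ring.
  rewrite in_qpolyD [X in _ + X](_ : _ = 0) ?addr0 //.
  by apply: val_inj; rewrite /= mkp (Pdiv.RingMonic.rmodpp p_monic).
have szX : (size ('X - a%:P)%R < 3)%N by rewrite size_XsubC.
have zE : Pdiv.CommonRing.rmodp ('X - a%:P) (mk_monic p) = 'X - a%:P.
  exact: small szX.
exists (fun (q : {poly %/ p}) t =>
  if t then (q : {poly k})`_1 else (q : {poly k}).[a]).
split=> [[] c u v|[] []|q] /=.
- by rewrite coefD coefZ.
- by rewrite hornerD hornerZ.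
- by rewrite zE coefB coefX coefC subr0.
- by rewrite zE !hornerE subrr.
- by rewrite coefC.
- by rewrite hornerC.
rewrite big_bool /=; apply: val_inj; rewrite /= zE.
have sq : (size (q : {poly k}) <= 2)%N.
  by rewrite -ltnS (leq_trans (size_mk_monic q)) // mkp p_deg2.
have qE : (q : {poly k}) = ((q : {poly k})`_0)%:P + (q : {poly k})`_1 *: 'X.
  apply/polyP=> -[|[|i]]; rewrite coefD coefZ coefX coefC /=;
    rewrite ?mulr0 ?mulr1 ?addr0 ?add0r //.
  by rewrite nth_default // (leq_trans sq).
by rewrite {1 3}qE !hornerE -!mul_polyC polyCD polyCM; ring.
Qed.

End Quadratic.

Section PureTensors.
Variables (k : fieldType) (U V : vectType k).

Lemma pure0l (v : V) : pure (0 : U) v = 0.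
Proof. by have := purePl (-1) 0 (0 : U) v; rewrite !scaleN1r !addNr. Qed.

Lemma pureDl (u u' : U) (v : V) :
  pure (u + u') v = pure u v + pure u' v.
Proof. by have := purePl 1 u u' v; rewrite !scale1r. Qed.

Lemma pureZl c (u : U) (v : V) : pure (c *: u) v = c *: pure u v.
Proof. by have := purePl c u 0 v; rewrite pure0l !addr0. Qed.

Lemma pure0r (u : U) : pure u (0 : V) = 0.
Proof. by have := purePr (-1) u (0 : V) 0; rewrite !scaleN1r !addNr. Qed.

Lemma pureDr (u : U) (v v' : V) :
  pure u (v + v') = pure u v + pure u v'.
Proof. by have := purePr 1 u v v'; rewrite !scale1r. Qed.

Lemma pureZr c (u : U) (v : V) : pure u (c *: v) = c *: pure u v.
Proof. by have := purePr c u v 0; rewrite pure0r !addr0. Qed.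

End PureTensors.

Section TwistedCoordinates.
Variables (k : fieldType) (n : nat) (B : fdkalgType k).
Local Notation A := {ffun 'I_n -> k^o}.
Variables (tau : twisting A B) (z : B) (g : k) (h : B -> bool -> k).
Hypothesis zz : z ** z = g *: z.
Hypothesis hP : coordinates (fun t : bool => if t then z else aone) h.

Let delta (i : 'I_n) : A := [ffun j => (i == j)%:R].
Let e i : twisted tau := pure (delta i) aone.
Let y : twisted tau := pure aone z.

Let pure_mull a a' b' :
  (pure a aone : twisted tau) ** pure a' b' = pure (a ** a') b'.
Proof.
rewrite /amul /= [LHS]twisted_mul_pure twist_1A tmap_amul_pure.
by rewrite amul1.
Qed.

Let pure_mulr b b' :
  (pure aone b : twisted tau) ** pure aone b' = pure aone (b ** b').
Proof.
rewrite /amul /= [LHS]twisted_mul_pure twist_1B tmap_amul_pure.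
by rewrite amul1.
Qed.

Let deltaM i j : delta i ** delta j = (i == j)%:R *: delta i.
Proof.
apply/ffunP=> l; rewrite /amul /= !ffunE /amul /=.
have [->|ij] := eqVneq i j; first by rewrite [RHS]mul1r -natrM mulnb andbb.
rewrite [RHS]mul0r; have [<-|_] := eqVneq i l; last by rewrite mul0r.
by rewrite mul1r eq_sym (negPf ij).
Qed.

Let eM i j : e i ** e j = (i == j)%:R *: e i.
Proof. by rewrite /e pure_mull deltaM pureZl. Qed.

Let e1 : \sum_i e i = aone.
Proof.
rewrite -[LHS](big_morph (fun a : A => pure a (aone : B) : twisted tau)
  (fun u v => pureDl u v aone) (pure0l _ aone)).
congr pure; apply/ffunP=> j; rewrite sum_ffunE ffunE (bigD1 j) //= ffunE eqxx.
by rewrite big1 ?addr0 // => i /negPf ij; rewrite ffunE ij.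
Qed.

Let yy : y ** y = g *: y.
Proof. by rewrite /y pure_mulr zz pureZr. Qed.

Let ey i : e i ** y = pure (delta i) z.
Proof. by rewrite /e /y pure_mull amula1. Qed.

(** Coordinates on a tensor product are products of coordinates; they exist as
linear functions by the universal property. *)
Lemma twisted_coordinates : exists f,
  coordinates (fun q => if q.2 then e q.1 ** y else e q.1) f.
Proof.
have [lh hz hK] := hP.
pose F (a : A) (b : B) : {ffun 'I_n * bool -> k^o} :=
  [ffun q => a q.1 * h b q.2].
have bF : bilin F.
  split=> [a c b b'|b c a a']; apply/ffunP=> -[i t]; rewrite !ffunE /=.
    by rewrite lh mulrDr mulrCA.
  by rewrite mulrDl scalerAl.
exists (fun x q => tlift F x q); split=> [q c x x'|[i t] [j t']|].
- by rewrite linearP !ffunE.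
- rewrite xpair_eqE /= ey.
  have -> : (if t then pure (delta i) z else e i) =
            pure (delta i) (if t then z else aone).
    by case: t.
  by rewrite tlift_pure // !ffunE hz -natrM mulnb.
apply: tensor_ext_lin => [|c x x'|a b].
- by [].
- rewrite scaler_sumr -big_split; apply: eq_bigr => q _ /=.
  by rewrite linearP !ffunE scalerDl scalerA.
have aE : a = \sum_i a i *: delta i.
  apply/ffunP=> j; rewrite sum_ffunE (bigD1 j) //= !ffunE eqxx.
  rewrite [_ *: _]mulr1 big1 ?addr0 // => i /negPf ij.
  by rewrite !ffunE ij scaler0.
rewrite big_pair_bool {1}aE (big_morph _ (fun u v => pureDl u v b) (pure0l _ b)).
apply: eq_bigr => i _; rewrite /= ey /e !tlift_pure // !ffunE /= pureZl.
by rewrite {1}(hK b) big_bool /= pureDr !pureZr scalerDr !scalerA.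
Qed.

Lemma twisted_product_isog : exists (t : nat) (Q : quiver),
  kalg_isog (twisted tau) ({ffun 'I_t -> 'M[k]_2} * path_algebra_lt2 k Q)%type.
Proof.
have [f fP] := twisted_coordinates.
have [s [c [c0 we]]] := shift_exists eM e1 fP.
have [s' [M [F [S [shape Tt]]]]] := has_table_twisted eM yy fP c0 we.
exact: twisted_table_isog shape Tt.
Qed.

End TwistedCoordinates.

Theorem theorem2p10 (k : fieldType) (n : nat) (n_ge2 : (2 <= n)%N)
    (p : {poly k}) (p_monic : p \is monic) (p_deg2 : size p = 3%N)
    (p_red : ~ irreducible_poly p)
    (tau : twisting {ffun 'I_n -> k^o} {poly %/ p}) :
  exists (t : nat) (Q : quiver),
    kalg_isog (twisted tau)
      ({ffun 'I_t -> 'M[k]_2} * path_algebra_lt2 k Q)%type.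
Proof.
have [a [b pE]] := quadratic_split p_monic p_deg2 p_red.
have [zz [f fP]] := qpoly_coordinates p_monic p_deg2 pE.
exact: twisted_product_isog tau _ _ _ zz fP.
Qed.
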